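(* For integers $n>m\ge 1$ and any prime power $q$, writing $u=n/m$, we have $$ r(n,m)=\lambda_q(m)\, e^\gamma\, \omega(u)\left(1+O\left(\frac{(u/e)^{-u}}{m}\right)\right),$$ and $$ \lambda_q(m)=e^{-H_m}\left(1+O\left(\frac{1}{m q^{(m+1)/2}}\right)\right)=\frac{e^{-\gamma}}{m}\left(1+O\left(\frac1m\right)\right),$$ where $H_m=\sum_{1\le k\le m}\frac1k$. The implied constants are absolute.
   Context: $\mathbb{F}_q$ is the finite field with $q$ elements. For integers $n\ge1$, $m\ge 0$, $r(n,m)$ denotes the proportion, among the $q^n$ monic polynomials of degree $n$ over $\mathbb{F}_q$, of those all of whose non-constant divisors have degree $>m$. $I_k$ denotes the number of monic irreducible polynomials of degree $k$ over $\mathbb{F}_q$, and $\lambda_q(m)=\prod_{k=1}^m (1-q^{-k})^{I_k}$. $\gamma$ is Euler's constant. Buchstab's function $\omega$ is defined by $\omega(u)=0$ for $u<1$, $\omega(u)=1/u$ for $1\le u\le 2$, and for $u\ge1$ it is the unique continuous function satisfying $(u\omega(u))'=\omega(u-1)$ for $u>2$. *)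

(* Defs.v *)
From HB Require Import structures.
From mathcomp Require Import all_boot all_order all_algebra.
From mathcomp Require Import all_classical all_reals all_analysis.
From mathcomp Require Import ring lra.

Set Implicit Arguments.
Unset Strict Implicit.
Unset Printing Implicit Defensive.

Import Order.TTheory GRing.Theory Num.Theory.
Import numFieldNormedType.Exports.
Local Open Scope classical_set_scope.
Local Open Scope ring_scope.

Section PolynomialsOverFiniteFields.
Variable F : finFieldType.

(* [{poly_n.+1 F}] is the finite type of polynomials of degree at most [n]. *)
Definition monic_deg (n : nat) : {set {poly_n.+1 F}} :=
  [set p : {poly_n.+1 F} |
    (val p \is monic) && (size (val p) == n.+1)].

Definition num_irred (k : nat) : nat :=
  #|[set p in monic_deg k | `[< irreducible_poly (val p) >]]|.

(* A divisor [d] of a nonzero polynomial is non-constant iff [1 < size d], and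
   its degree is [(size d).-1]. *)
Definition rough (m : nat) (p : {poly F}) : Prop :=
  forall d : {poly F},
    (d %| p)%R -> (1 < size d)%N -> (m < (size d).-1)%N.

Definition rough_prop (R : realType) (n m : nat) : R :=
  #|[set p in monic_deg n | `[< rough m (val p) >]]|%:R / #|F|%:R ^+ n.

Definition lambda (R : realType) (m : nat) : R :=
  \prod_(1 <= k < m.+1) (1 - #|F|%:R ^- k) ^+ num_irred k.

End PolynomialsOverFiniteFields.

Definition Hsum (R : realType) (m : nat) : R := \sum_(1 <= k < m.+1) k%:R^-1.

Definition euler_gamma (R : realType) : R :=
  limn (fun m : nat => Hsum R m - ln m%:R).

(* [a = b (1 + O(E))] with implied constant [C]. *)
Definition eq_mul1O (R : realType) (C a b E : R) : Prop :=
  exists2 theta : R, a = b * (1 + theta) & `|theta| <= C * E.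

(* [w] jumps at [1], so continuity is only required on [1, +oo). *)
Definition is_buchstab (R : realType) (w : R -> R) : Prop :=
  [/\ forall u : R, u < 1 -> w u = 0,
      forall u : R, 1 <= u <= 2 -> w u = u^-1,
      {within `[1, +oo[, continuous w}
    & forall u : R, 2 < u ->
        is_derive u 1 (fun t : R => t * w t : R) (w (u - 1))].

Section BuchstabExistence.
Variable R : realType.
Implicit Types (f g w : R -> R) (u x : R).
Notation mu := (@lebesgue_measure R).

Let prim f x : R :=
  (\int[mu]_(t in `[0%R, x]) f t)%R - (\int[mu]_(t in `[0%R, 1%R]) f t)%R.

Let prim_derive f x : continuous f -> 0 < x -> is_derive x 1 (prim f) (f x).
Proof.
move=> cf x0.
have xx : x < x + 1 by lra.
have intf : mu.-integrable `[0, x + 1] (EFin \o f).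
  apply: continuous_compact_integrable; first exact: segment_compact.
  by apply: continuous_subspaceT.
have [dF eF] := continuous_FTC1_closed xx intf x0 (cf x).
rewrite -(subr0 (f x)); apply: is_deriveB.
by split => //; rewrite -derive1E.
Qed.

Let prim_cont f x : continuous f -> 0 < x -> {for x, continuous (prim f)}.
Proof.
move=> cf x0; apply: differentiable_continuous; apply/derivable1_diffP.
by have [] := prim_derive cf x0.
Qed.

Let approx_step f u : R := (1 + prim f (Num.max 1 (u - 1))) / Num.max 1 u.

Let approx (k : nat) : R -> R :=
  iter k approx_step (fun u => (Num.max 1 u)^-1).

Let max1_gt0 u : 0 < Num.max 1 u.
Proof. by rewrite lt_max ltr01. Qed.

Let max1_cont : continuous (fun u : R => Num.max 1 u).
Proof. by move=> x; apply: continuous_max; [exact: cst_continuous|exact: id]. Qed.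

Let inv_max1_cont : continuous (fun u : R => (Num.max 1 u)^-1).
Proof. by move=> x; apply: cvgV; [rewrite gt_eqF|exact: max1_cont]. Qed.

Let approx_cont k : continuous (approx k).
Proof.
elim: k => [|k IH] x /=; first exact: inv_max1_cont.
apply: cvgM; last exact: inv_max1_cont.
apply: cvgD; first exact: cvg_cst.
apply: (@continuous_comp _ _ _ (fun u : R => Num.max 1 (u - 1)) (prim (approx k))).
  apply: (@continuous_comp _ _ _ (fun u : R => u - 1) (fun u : R => Num.max 1 u)).
    by apply: cvgB; [exact: cvg_id|exact: cvg_cst].
  exact: max1_cont.
by apply: prim_cont.
Qed.

Let approxS k u : u <= k.+2%:R -> approx k.+1 u = approx k u.
Proof.
elim: k u => [|k IH] u uk.
  rewrite /= /approx_step max_l; last by lra.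
  by rewrite /prim subrr addr0 mul1r.
rewrite [LHS]/= [RHS]/= -/(approx k.+1) -/(approx k) /approx_step.
congr ((1 + _) / _); rewrite /prim; congr (_ - _); apply: eq_Rintegral => t.
  rewrite inE/= in_itv/= => /andP[t0]; rewrite le_max => /orP[] tu.
    by apply: IH; rewrite (le_trans tu)// ler1n.
  by apply: IH; rewrite (le_trans tu)// lerBlDr natr1.
rewrite inE/= in_itv/= => /andP[t0 t1]; apply: IH.
by rewrite (le_trans t1)// ler1n.
Qed.

Let approx_le k l u : (k <= l)%N -> u <= k.+2%:R -> approx l u = approx k u.
Proof.
move=> /subnK <-; elim: (l - k)%N => [//|j IH] uk.
by rewrite addSn approxS ?IH// (le_trans uk)// ler_nat !ltnS leq_addl.
Qed.

Let sol u : R := approx (Num.bound `|u|) u.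

Let solE k u : u <= k.+2%:R -> sol u = approx k u.
Proof.
move=> uk; have ub : u <= (Num.bound `|u|).+2%:R.
  rewrite (le_trans (ler_norm u))// (le_trans (ltW (archi_boundP _)))//.
  by rewrite ler_nat; apply: leq_trans (leqnSn _).
rewrite /sol; have [kb|bk] := leqP k (Num.bound `|u|).
  exact: approx_le.
by rewrite (approx_le (ltnW bk)).
Qed.

Let sol_near u : \forall x \near u, sol x = approx (Num.bound `|u|) x.
Proof.
have ub : u < (Num.bound `|u|).+2%:R.
  rewrite (le_lt_trans (ler_norm u))// (lt_trans (archi_boundP _))//.
  by rewrite ltr_nat.
by near do apply/solE/ltW; exact: lt_nbhsl.
Unshelve. all: by end_near. Qed.

Let sol_cont : continuous sol.
Proof.
move=> u; have := @approx_cont (Num.bound `|u|) u.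
rewrite /continuous_at (nbhs_singleton (sol_near u)).
apply: cvg_trans; apply: near_eq_cvg.
by near=> x; rewrite (near (sol_near u) x).
Unshelve. all: end_near.
Qed.

Lemma buchstab_exists : exists w, is_buchstab w.
Proof.
exists (fun u => if u < 1 then 0 else sol u); split.
- by move=> u ->.
- move=> u /andP[u1 u2]; rewrite ltNge u1/= (@solE 0)//= max_r//.
- have eqsol (u : R) : 1 <= u -> sol u = if u < 1 then 0 else sol u.
    by rewrite leNgt => /negbTE ->.
  apply: (@subspace_eq_continuous _ _ _ sol); last exact: continuous_subspaceT.
  by move=> u; rewrite inE/= in_itv/= andbT => /eqsol.
move=> u u2; have -> : (u - 1 < 1) = false by apply/negbTE; rewrite -leNgt; lra.
have [k uk] : exists k : nat, u < k.+3%:R.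
  exists (Num.bound `|u|).
  rewrite (le_lt_trans (ler_norm u))// (lt_trans (archi_boundP _))//.
  by rewrite ltr_nat ltnS leqW.
rewrite (@solE k); last by rewrite lerBlDr natr1 ltW.
have := @near_eq_is_derive R R R (fun t => 1 + prim (approx k) (t - 1)) (fun t => t * (if t < 1 then 0 else sol t)) u 1 (approx k (u - 1)); apply.
- near=> t.
  have t2 : 2 < t by near: t; exact: lt_nbhsr.
  rewrite ltNge (_ : 1 <= t) /=; last by lra.
  rewrite (@solE k.+1); last by rewrite ltW//; near: t; exact: lt_nbhsl.
  rewrite /= /approx_step !max_r; [|lra|lra].
  by rewrite mulrC divfK// gt_eqF//; lra.
rewrite -[approx k (u - 1)]add0r; apply: is_deriveD.
rewrite -[approx k (u - 1)]mulr1.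
apply: (@is_derive1_comp _ (prim (approx k)) (fun t => t - 1)).
  by apply: prim_derive; [exact: approx_cont|lra].
by rewrite -[X in is_derive _ _ _ X]subr0; apply: is_deriveB.
Unshelve. all: by end_near. Qed.

Lemma buchstab_uniq w1 w2 : is_buchstab w1 -> is_buchstab w2 -> w1 = w2.
Proof.
move=> [w1lt w1le w1c w1d] [w2lt w2le w2c w2d].
suff H k : forall u, u <= k.+2%:R -> w1 u = w2 u.
  apply/funext => u; apply: (H (Num.bound `|u|)).
  rewrite (le_trans (ler_norm u))// (le_trans (ltW (archi_boundP _)))//.
  by rewrite ler_nat; apply: leq_trans (leqnSn _).
elim: k => [|k IH] u uk.
  have [u1|u1] := ltP u 1; first by rewrite w1lt ?w2lt.
  by rewrite w1le ?w2le ?u1.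
have [u2|u2] := leP u 2; first by apply: IH; rewrite (le_trans u2)// ler_nat.
pose d (t : R) : R := t * w1 t - t * w2 t.
have dd x : x \in `]2, u[ -> is_derive x 1 d 0.
  rewrite in_itv/= => /andP[x2 xu].
  have -> : 0 = w1 (x - 1) - w2 (x - 1).
    rewrite (IH (x - 1)) ?subrr// lerBlDr natr1; exact: le_trans (ltW xu) uk.
  by apply: is_deriveB; [exact: w1d|exact: w2d].
have sub : `[2, u] `<=` `[1, +oo[.
  by move=> x /=; rewrite !in_itv/= andbT => /andP[x2 _]; lra.
have dc : {within `[2, u], continuous d}.
  move=> x; apply: cvgB; apply: cvgM.
  - exact: (continuous_subspaceT (fun=> cvg_id)).
  - exact: (continuous_subspaceW sub w1c).
  - exact: (continuous_subspaceT (fun=> cvg_id)).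
  - exact: (continuous_subspaceW sub w2c).
have [c _] := MVT u2 dd dc.
rewrite mul0r => /eqP; rewrite subr_eq0 => /eqP.
have -> : d 2 = 0 by rewrite /d w1le ?w2le ?subrr//; lra.
move=> /eqP; rewrite /d -mulrBr mulf_eq0 gt_eqF/=; last by lra.
by rewrite subr_eq0 => /eqP.
Qed.

Definition buchstab : R -> R := xget (fun=> 0) (@is_buchstab R).

Lemma buchstabP : is_buchstab buchstab.
Proof. by have [w] := buchstab_exists; exact: xgetI. Qed.

End BuchstabExistence.

(* Main.v *)
(* Write [a n = r(n,m)], [u = n/m] and [G(z) = prod_(k <= m) (1 - (z/q)^k)^(I_k)]. Removing the
   irreducibles of degree at most [m] one at a time shows that [a n] is the sum of the first [n + 1]
   coefficients of [G], while [lambda(m) = G(1)]. Since [a n = 0] for [1 <= n <= m], the logarithmic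
   derivative [- z G'/G] has its first [m] coefficients equal to [1] (Gauss' formula), and the later
   ones are [O(q^(-i/2))]. This yields the formula for [lambda(m)] and the recursion
   [(n+1) (a(n+1) - a n) = a(n-m) - a n + O(q^(-m/2))].

   If [m <= A u^4], Rankin's trick at [x = u^(1/m)] bounds the tail of [G(1)] by a constant times
   [m^-2 (u/e)^-u].

   Otherwise [a n] is compared with [w(n/m)/m], [w] being Buchstab's function, which satisfies the
   same recursion up to an error controlled by [w']. As [u w'(u) = w(u-1) - w(u)], the derivative of
   [u^-u] majorizes [w']; likewise the increments of [(u/e)^-u] form a supersolution of the recursion
   for the increments of the error, because [((u-1)/e)^-(u-1)] is at most [u (u/e)^-u] and the mean
   over a window of length [m] gains a factor [log u]. So the error converges at the rate
   [m^-2 (u/e)^-u] to a value known from the case of large [u]. Letting [m] tend to infinity identifies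
   the limit of [w] as [exp(-gamma)]. *)
Require Import Defs.
From HB Require Import structures.
From mathcomp Require Import all_boot all_order all_algebra.
From mathcomp Require Import all_classical all_reals all_analysis.
From mathcomp Require Import ring lra zify.

Import Order.TTheory GRing.Theory Num.Theory.
Import numFieldNormedType.Exports.
Local Open Scope classical_set_scope.
Local Open Scope ring_scope.

Set Implicit Arguments.
Unset Strict Implicit.
Unset Printing Implicit Defensive.

(** * Sieving by irreducible polynomials *)

Section Sieve.
Variable F : finFieldType.
Implicit Types (P p g d : {poly F}) (L : seq {poly F}).

Definition nodiv L p := all (fun P => ~~ (P %| p)) L.

Definition nodiv_count L n :=
  #|[set p in monic_deg F n | nodiv L (val p)]|.

(** A non-constant monic divisor of least size is irreducible: any non-constant divisor of it, made
    monic, has at least the same size. *)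
Lemma monic_irreducible_factor p : (1 < size p)%N ->
  exists P, [/\ P \is monic, irreducible_poly P & P %| p].
Proof.
move=> sp; have p0 : p != 0 by rewrite -size_poly_gt0 ltnW.
pose Q (s : nat) := `[< exists d, [/\ d \is monic, d %| p, (1 < size d)%N & size d = s] >].
have exQ : exists s, Q s.
  exists (size p); apply/asboolP; exists ((lead_coef p)^-1 *: p).
  have l0 : (lead_coef p)^-1 != 0 by rewrite invr_eq0 lead_coef_eq0.
  by rewrite dvdpZl// size_scale// monicE lead_coefZ mulVf ?lead_coef_eq0.
case: (ex_minnP exQ) => s /asboolP[d [md dp sd ds]] mins.
exists d; split=> //; split=> // q sq qd.
have d0 : d != 0 by rewrite -size_poly_gt0 ltnW.
have q0 : q != 0 by apply: dvdpN0 d0.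
have sq1 : (1 < size q)%N.
  by move: sq q0; rewrite -size_poly_gt0; case: (size q) => [|[]].
rewrite -dvdp_size_eqp// eqn_leq dvdp_leq//= ds; apply: mins; apply/asboolP.
have l0 : (lead_coef q)^-1 != 0 by rewrite invr_eq0 lead_coef_eq0.
exists ((lead_coef q)^-1 *: q); rewrite dvdpZl// size_scale//.
by rewrite monicE lead_coefZ mulVf ?lead_coef_eq0 // (dvdp_trans qd).
Qed.

(** Distinct monic irreducibles are coprime, so a factor [P] outside [L] does not affect
    divisibility by the members of [L]. *)
Lemma nodivM L P g :
  {in P :: L, forall Q, Q \is monic /\ irreducible_poly Q} -> P \notin L ->
  nodiv L (P * g) = nodiv L g.
Proof.
move=> HL PL; apply: eq_in_all => Q QL; congr (~~ _); apply: Gauss_dvdpr.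
have [mP iP] := HL P (mem_head _ _).
have [mQ iQ] : Q \is monic /\ irreducible_poly Q by apply: HL; rewrite inE QL orbT.
rewrite irreducible_poly_coprime//; apply/negP => QP.
have sQ : size Q != 1 by rewrite gtn_eqF//; case: iQ.
move: (apply_irredp iP sQ QP); rewrite eqp_monic// => /eqP QP'.
by rewrite -QP' QL in PL.
Qed.

(** The multiples of [P] that avoid [L] are counted through the injection [g -> P * g], which
    preserves avoidance of [L] by [nodivM]. *)
Lemma nodiv_count_cons L P n :
  {in P :: L, forall Q, Q \is monic /\ irreducible_poly Q} -> P \notin L ->
  (nodiv_count (P :: L) n +
   (if ((size P).-1 <= n)%N then nodiv_count L (n - (size P).-1) else 0) =
   nodiv_count L n)%N.
Proof.
move=> HL PL; have [mP iP] := HL P (mem_head _ _).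
have sP : (1 < size P)%N by case: iP.
have P0 : P != 0 by rewrite monic_neq0.
set e := (size P).-1; have eP : size P = e.+1 by rewrite prednK// ltnW.
rewrite /nodiv_count.
set A := [set p in monic_deg F n | nodiv L (val p)].
pose B : {set {poly_n.+1 F}} := [set p : {poly_n.+1 F} | P %| val p]%SET.
rewrite -(cardsID B A) addnC; congr (_ + _)%N; last first.
  apply: eq_card => p; rewrite !inE /= -!andbA.
  by do !case: (X in X && _ = _) => //=; rewrite !(andbC (~~ _)) ?andbA.
have [en|ne] := leqP e n; last first.
  apply/esym/eqP; rewrite cards_eq0; apply/eqP/setP => p; rewrite !inE.
  apply/negbTE/negP => /andP[/andP[/andP[mp /eqP sp] _] Pp].
  have := dvdp_leq (monic_neq0 mp) Pp; rewrite eP sp ltnS => ?.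
  by move: ne; rewrite ltnNge => /negP.
set C := [set p in monic_deg F (n - e) | nodiv L (val p)].
pose f (g : {poly_(n - e).+1 F}) : {poly_n.+1 F} := npolyp n.+1 (P * val g).
have vf (g : {poly_(n - e).+1 F}) : val (f g) = P * val g.
  rewrite /f; apply: npolypK; rewrite (leq_trans (size_polyMleq _ _))// eP.
  have := size_npoly g => /=; move: (size _) => s; lia.
rewrite -(@card_in_imset _ _ f C); last first.
  move=> g h _ _ /(congr1 val); rewrite !vf => /(mulfI P0) gh.
  exact: val_inj.
apply: eq_card => p; rewrite !inE; apply/imsetP/idP.
  move=> [g]; rewrite !inE => /andP[/andP[mg /eqP sg] Lg] ->.
  rewrite vf nodivM// Lg dvdp_mulr// !andbT monicMl// mg/=.
  by rewrite size_monicM// ?monic_neq0// eP sg; apply/eqP; lia.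
move=> /andP[/andP[/andP[mp /eqP sp] Lp] /dvdpP[g pg]].
rewrite mulrC in pg; have mg : g \is monic by rewrite -(monicMl _ mP) -pg.
have sg : size g = (n - e).+1.
  have : size (P * g) = n.+1 by rewrite -pg.
  by rewrite size_monicM// ?monic_neq0// eP; move: (size g) => s; lia.
have vg : val (npolyp (n - e).+1 g) = g by apply: npolypK; rewrite sg.
exists (npolyp (n - e).+1 g).
  by rewrite !inE vg mg sg eqxx -(nodivM g HL PL) -pg Lp.
by apply: val_inj; rewrite vf vg.
Qed.

Lemma card_monic_deg n : #|monic_deg F n| = (#|F| ^ n)%N.
Proof.
rewrite -(card_npoly F n) -cardsT.
pose f (g : {poly_n F}) : {poly_n.+1 F} := npolyp n.+1 ('X^n + val g).
have sf (g : {poly_n F}) : size ('X^n + val g) = n.+1.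
  by rewrite size_polyDl ?size_polyXn// ltnS; exact: size_npoly.
have vf (g : {poly_n F}) : val (f g) = 'X^n + val g by apply: npolypK; rewrite sf.
rewrite -(@card_in_imset _ _ f [set: {poly_n F}]%SET); last first.
  move=> g h _ _ /(congr1 val); rewrite !vf => /addrI gh.
  exact: val_inj.
apply: eq_card => p; rewrite !inE; apply/idP/imsetP => [/andP[mp /eqP sp]|[g _ ->]].
  have sg : (size (val p - 'X^n)%R <= n)%N.
    apply/leq_sizeP => j; rewrite leq_eqVlt coefB coefXn => /predU1P[<-|nj].
      by rewrite eqxx; move: mp; rewrite monicE /lead_coef sp/= => /eqP ->; rewrite subrr.
    by rewrite gtn_eqF// subr0 nth_default// sp.
  exists (npolyp n (val p - 'X^n)) => //; apply: val_inj.
  rewrite vf (_ : val (npolyp n _) = val p - 'X^n); first by rewrite addrC subrK.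
  exact: npolypK.
rewrite vf sf eqxx andbT monicE lead_coefDl ?lead_coefXn//.
by rewrite size_polyXn ltnS; exact: size_npoly.
Qed.

Lemma nodiv_count_nil n : nodiv_count [::] n = (#|F| ^ n)%N.
Proof. by rewrite -card_monic_deg; apply: eq_card => p; rewrite !inE andbT. Qed.

End Sieve.

(** * Normalised generating polynomial of the rough proportions *)

Section Generating.
Variables (F : finFieldType) (R : realType).
Local Notation q := (#|F|%:R : R).

Lemma card_field_gt1 : 1 < q.
Proof. by rewrite ltr1n card_finNzRing_gt1. Qed.

Lemma card_field_gt0 : 0 < q.
Proof. exact: lt_trans ltr01 card_field_gt1. Qed.
Hint Resolve card_field_gt0 : core.

(** The Euler factor [1 - (z/q)^e] of an irreducible of degree [e]; the variable is rescaled by [q]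
    since proportions, not counts, are recorded. *)
Definition sieve_factor (e : nat) : {poly R} := 1 - (q ^- e)%:P * 'X^e.

Lemma sum_coef_sieve_factor (g : {poly R}) e n :
  \sum_(j < n.+1) (sieve_factor e * g)`_j =
  \sum_(j < n.+1) g`_j -
  (if (e <= n)%N then q ^- e * \sum_(j < (n - e).+1) g`_j else 0).
Proof.
under eq_bigr do rewrite mulrBl mul1r coefB -mulrA coefCM coefXnM.
rewrite sumrB; congr (_ - _); rewrite -mulr_sumr.
have [en|ne] := leqP e n; last first.
  rewrite big1 ?mulr0// => j _.
  by rewrite (leq_trans (ltn_ord j) ne).
congr (_ * _).
transitivity (\sum_(0 <= j < n.+1) (if (j < e)%N then 0 else g`_(j - e))).
  by rewrite big_mkord.
rewrite (@big_cat_nat _ _ _ e) //=; last exact: leqW.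
rewrite big_nat_cond big1 ?add0r; last by move=> j /andP[/andP[_ ->]].
rewrite -{1}(add0n e) big_addn subSn// big_mkord; apply: eq_bigr => j _.
by rewrite ltnNge leq_addl addnK.
Qed.

(** Induction on [L]: by [sum_coef_sieve_factor], a new factor changes the partial sums of
    coefficients exactly as [nodiv_count_cons] changes the counts divided by [q ^+ n]. For empty [L]
    both sides are [1]. *)
Lemma nodiv_prop_coef L n :
  uniq L -> {in L, forall Q : {poly F}, Q \is monic /\ irreducible_poly Q} ->
  (nodiv_count L n)%:R / q ^+ n =
  \sum_(j < n.+1) (\prod_(P <- L) sieve_factor (size P).-1)`_j.
Proof.
elim: L n => [|P L IH] n.
  move=> _ _; rewrite nodiv_count_nil natrX divff ?expf_neq0 ?gt_eqF//.
  rewrite big_nil big_ord_recl coef1 big1 ?addr0// => i _.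
  by rewrite coef1.
rewrite cons_uniq => /andP[PL uL] HL.
have HL' : {in L, forall Q : {poly F}, Q \is monic /\ irreducible_poly Q}.
  by move=> Q QL; apply: HL; rewrite inE QL orbT.
rewrite big_cons sum_coef_sieve_factor -IH//; apply/eqP; rewrite eq_sym subr_eq.
apply/eqP; rewrite -(nodiv_count_cons n HL PL) natrD mulrDl; congr (_ + _).
case: ifP => [en|]; last by rewrite mul0r.
have -> : q ^+ n = q ^+ (n - (size P).-1) * q ^+ (size P).-1 by rewrite -exprD subnK.
by rewrite -IH// invfM [RHS]mulrC mulrA.
Qed.

Fixpoint irr_upto (m : nat) : seq {poly F} :=
  if m is m'.+1 then
    irr_upto m' ++
    [seq val p | p <- enum [set p in monic_deg F m | `[< irreducible_poly (val p) >]]]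
  else [::].

Lemma mem_irr_upto m (P : {poly F}) :
  reflect [/\ P \is monic, irreducible_poly P & ((size P).-1 <= m)%N]
    (P \in irr_upto m).
Proof.
elim: m => [|m IH] /=.
  rewrite in_nil; constructor => -[_ [sP _]]; rewrite leqn0 => /eqP eP.
  by move: sP; rewrite -ltn_predRL eP.
rewrite mem_cat; apply: (iffP orP) => [[/IH[? ? ?]|/mapP[p]]|[mP iP]].
- by split=> //; exact: leqW.
- rewrite mem_enum !inE => /andP[/andP[mp /eqP sp] /asboolP ip] ->.
  by split=> //; rewrite sp.
rewrite leq_eqVlt => /predU1P[eP|]; last by left; apply/IH.
right; have sP : size P = m.+2.
  by case: iP; rewrite -eP; case: (size P) => // -[].
have vP : val (npolyp m.+2 P) = P by apply: npolypK; rewrite sP.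
apply/mapP; exists (npolyp m.+2 P) => //.
have iP' : irreducible_poly (val (npolyp m.+2 P)) by rewrite vP.
by rewrite mem_enum !inE (asboolT iP') vP mP sP eqxx.
Qed.

Lemma uniq_irr_upto m : uniq (irr_upto m).
Proof.
elim: m => //= m IH; rewrite cat_uniq IH (map_inj_uniq val_inj) enum_uniq andbT/=.
apply/hasPn => P /mapP[p]; rewrite mem_enum !inE => /andP[/andP[_ /eqP sp] _] ->.
by apply/negP => /mem_irr_upto[_ _]; rewrite sp ltnn.
Qed.

Definition sieve_poly (m : nat) : {poly R} :=
  \prod_(1 <= k < m.+1) sieve_factor k ^+ num_irred F k.

Lemma prod_irr_upto m :
  \prod_(P <- irr_upto m) sieve_factor (size P).-1 = sieve_poly m.
Proof.
rewrite /sieve_poly; elim: m => [|m IH]; first by rewrite /= big_nil big_geq.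
rewrite /= big_cat/= IH [RHS]big_nat_recr//=; congr (_ * _).
rewrite big_map big_enum/= -prodr_const; apply: eq_bigr => p.
by rewrite !inE => /andP[/andP[_ /eqP ->] _].
Qed.

(** A non-constant divisor of degree at most [m] has a monic irreducible factor of degree at most
    [m]; conversely, a listed irreducible dividing [p] is itself such a divisor. *)
Lemma roughE m (p : {poly F}) : p \is monic -> rough m p <-> nodiv (irr_upto m) p.
Proof.
move=> mp; split=> [rp|/allP np d dp sd].
  apply/allP => P /mem_irr_upto[mP [sP _]]; rewrite leqNgt => eP.
  by apply/negP => /rp /(_ sP) meP; rewrite meP in eP.
have [P [mP iP Pd]] := monic_irreducible_factor sd.
have d0 : d != 0 by rewrite -size_poly_gt0 ltnW.
have := np P; rewrite (dvdp_trans Pd dp) => /contraTN/(_ isT) Pm.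
rewrite ltnNge; apply: contra Pm => dm; apply/mem_irr_upto; split=> //.
rewrite (leq_trans _ dm)//; have := dvdp_leq d0 Pd.
by move: (size P) (size d) => ? ?; lia.
Qed.

Lemma rough_prop_coef n m :
  rough_prop F R n m = \sum_(j < n.+1) (sieve_poly m)`_j.
Proof.
rewrite -prod_irr_upto -nodiv_prop_coef ?uniq_irr_upto//; last first.
  by move=> P /mem_irr_upto[].
congr (_%:R / _); apply: eq_card => p; rewrite !inE; apply/andP/andP => -[mp];
  have /andP[mp' _] := mp; split=> //.
  by apply/(roughE m mp')/asboolP.
by apply/asboolP/(roughE m mp').
Qed.

Lemma sieve_poly1 m : (sieve_poly m).[1] = lambda F R m.
Proof.
rewrite horner_prod; apply: eq_bigr => k _.
by rewrite horner_exp !hornerE expr1n mulr1.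
Qed.

Lemma sieve_poly0 m : (sieve_poly m)`_0 = 1.
Proof.
rewrite -horner_coef0 horner_prod big_nat_cond big1// => k /andP[/andP[k0 _] _].
by rewrite horner_exp !hornerE expr0n gtn_eqF// mulr0 subr0 expr1n.
Qed.

Lemma rough_prop0 m : rough_prop F R 0 m = 1.
Proof. by rewrite rough_prop_coef big_ord1 sieve_poly0. Qed.

Lemma rough_prop_eq0 n m : (0 < n <= m)%N -> rough_prop F R n m = 0.
Proof.
move=> /andP[n0 nm]; rewrite /rough_prop (_ : #|_| = 0)%N ?mul0r//.
apply/eqP; rewrite cards_eq0; apply/eqP/setP => p; rewrite !inE.
apply/negP => /andP[/andP[_ /eqP sp] /asboolP /(_ (val p) (dvdpp _))].
by rewrite sp ltnS => /(_ n0); rewrite ltnNge nm.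
Qed.

Lemma rough_prop_ge0 n m : 0 <= rough_prop F R n m.
Proof. by rewrite divr_ge0// exprn_ge0. Qed.

Lemma rough_prop_le1 n m : rough_prop F R n m <= 1.
Proof.
rewrite ler_pdivrMr ?exprn_gt0// mul1r -natrX ler_nat -card_monic_deg.
by apply: subset_leq_card; apply/fintype.subsetP => p; rewrite inE => /andP[].
Qed.

Lemma sieve_poly_coefS n m :
  (sieve_poly m)`_n.+1 = rough_prop F R n.+1 m - rough_prop F R n m.
Proof. rewrite !rough_prop_coef [in X in X - _]big_ord_recr/=.
by rewrite addrAC subrr add0r. Qed.

(* For [0 < i], the [i]-th coefficient of [- z G' / G], where [G = sieve_poly m]. *)
Definition logder_coef (m i : nat) : R :=
  q ^- i * (\sum_(1 <= k < m.+1 | (k %| i)%N) k * num_irred F k)%N%:R.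

(** Logarithmic derivatives add under products. The divisibility says that [X h' = - h B] modulo
    [X^N], so that [B] truncates [- X h'/h] without recourse to power series. *)
Lemma logder_dvdp (N : nat) (B : nat -> {poly R}) (I : nat -> nat) (h : nat -> {poly R}) m :
  (forall k, (0 < k)%N -> 'X^N %| 'X * (h k)^`() + h k * B k) ->
  let G := \prod_(1 <= k < m.+1) h k ^+ I k in
  'X^N %| 'X * G^`() + G * \sum_(1 <= k < m.+1) B k *+ I k.
Proof.
move=> hB; have mulP (f1 f2 B1 B2 : {poly R}) :
    'X^N %| 'X * f1^`() + f1 * B1 -> 'X^N %| 'X * f2^`() + f2 * B2 ->
    'X^N %| 'X * (f1 * f2)^`() + (f1 * f2) * (B1 + B2).
  move=> d1 d2; rewrite (_ : _ + _ = f2 * ('X * f1^`() + f1 * B1) + f1 * ('X * f2^`() + f2 * B2)).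
    by rewrite dvdp_add// dvdp_mull.
  by rewrite derivM; ring.
have oneP : 'X^N %| 'X * (1 : {poly R})^`() + 1 * 0.
  by rewrite derivC mulr0 mulr0 addr0 dvdp0.
elim: m => [|m IH] /=; first by rewrite !big_geq.
rewrite !(big_nat_recr m.+1)//=; apply: (mulP) => //.
elim: (I m.+1) => [|j IHj]; first by rewrite expr0 mulr0n.
by rewrite exprS mulrS; apply: (mulP) => //; exact: hB.
Qed.

Lemma sieve_poly_recursion m n :
  n%:R * (sieve_poly m)`_n =
  - \sum_(1 <= i < n.+1) logder_coef m i * (sieve_poly m)`_(n - i).
Proof.
(* [B k] truncates [k y / (1 - y)] with [y = (X/q)^k], which is [- X h'/h] for [h = 1 - y]. *)
pose B (k : nat) : {poly R} := \sum_(1 <= j < n.+1) (k%:R * q ^- k ^+ j) *: 'X^(k * j).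
have hB k : (0 < k)%N -> 'X^(n.+1) %| 'X * (sieve_factor k)^`() + sieve_factor k * B k.
  move=> k0; rewrite /sieve_factor; set c := q ^- k; set y := c%:P * 'X^k.
  have -> : B k = k%:R *: \sum_(1 <= j < n.+1) y ^+ j.
    rewrite scaler_sumr; apply: eq_bigr => j _.
    by rewrite exprMn -polyC_exp mul_polyC scalerA exprM.
  have -> : \sum_(1 <= j < n.+1) y ^+ j = y * \sum_(j < n) y ^+ j.
    rewrite big_add1 big_mkord mulr_sumr; apply: eq_bigr => j _.
    by rewrite exprS.
  have dy : 'X * y^`() = k%:R *: y.
    rewrite /y derivM derivC mul0r add0r derivXn mulrnAr mulrnAr mulrCA -exprS prednK//.
    by rewrite scaler_nat.
  have -> : (1 - y) * (k%:R *: (y * \sum_(j < n) y ^+ j)) = k%:R *: (y - y ^+ n.+1).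
    rewrite -scalerAr mulrCA -opprB mulNr -subrX1 opprB mulrBr mulr1.
    by rewrite -exprS.
  rewrite derivB derivC sub0r mulrN dy addrC -scalerBr addrAC subrr sub0r.
  rewrite dvdpZr ?pnatr_eq0 -?lt0n// dvdpNr /y exprMn dvdp_mull//.
  by rewrite -exprM dvdp_exp2l// leq_pmull.
have cB k i : (0 < k)%N -> (0 < i <= n)%N ->
    (B k)`_i = if (k %| i)%N then k%:R * q ^- i else 0.
  move=> k0 /andP[i0 iN]; rewrite coef_sum.
  under eq_bigr do rewrite coefZ coefXn.
  case: ifP => [/dvdnP[j0 ij]|/negP ki]; last first.
    rewrite big1// => j _; case: eqP => [ij|]; last by rewrite mulr0.
    by case: ki; rewrite ij dvdn_mulr.
  rewrite (eq_bigr (fun j => if (j == j0)%N then k%:R * q ^- i else 0)); last first.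
    move=> j _; rewrite ij mulnC eqn_pmul2l// [(j0 == j)%N]eq_sym.
    case: eqP => [->|]; last by rewrite mulr0.
    by rewrite mulr1 exprVn -exprM.
  rewrite -big_mkcond big_nat1_eq ifT//; apply/andP; split.
    by move: i0; rewrite ij muln_gt0 => /andP[].
  by rewrite ltnS (leq_trans _ iN)// ij leq_pmulr.
have := @logder_dvdp n.+1 B (num_irred F) sieve_factor m hB.
rewrite /= -/(sieve_poly m); set Bt := \sum_(_ <= _ < _) _ => /dvdpP[g /polyP/(_ n)].
rewrite coefMXn ltnSn coefD coefXM coefMr big_ord_recl/=.
have -> : Bt`_0 = 0.
  rewrite coef_sum big_nat_cond big1// => k /andP[/andP[k0 _] _].
  rewrite coefMn coef_sum big_nat_cond big1 ?mul0rn// => j /andP[/andP[j0 _] _].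
  by rewrite coefZ coefXn eq_sym muln_eq0 !gtn_eqF// mulr0.
rewrite mulr0 add0r => /eqP; rewrite addr_eq0 => /eqP H.
transitivity (if n == 0%N then 0 else (sieve_poly m)^`()`_n.-1).
  by case: n {B hB cB Bt H g} => [|n]; rewrite ?mul0r// coef_deriv mulr_natl.
rewrite H big_add1 big_mkord; congr (- _); apply: eq_bigr => i _.
rewrite mulrC; congr (_ * _).
rewrite coef_sum /logder_coef natr_sum mulr_sumr [RHS]big_mkcond/=.
apply: eq_big_nat => k /andP[k0 _].
rewrite coefMn cB//; last by rewrite /= ltn_ord.
by case: ifP => _; rewrite ?mul0rn// natrM mulrA [_ ^-1 * k%:R]mulrC mulr_natr.
Qed.

End Generating.

(** * Recursion for the proportion of rough polynomials *)

Section LogSeries.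
Variable R : realType.
Implicit Types t y : R.

Lemma is_derive_log_series J t :
  is_derive t 1 (fun x : R => \sum_(1 <= j < J.+1) x ^+ j / j%:R) (\sum_(j < J) t ^+ j).
Proof.
elim: J => [|J IH].
  rewrite big_ord0 (_ : (fun _ => _) = cst 0); first exact: is_derive_cst.
  by apply/funext => x; rewrite big_geq.
rewrite big_ord_recr/= (_ : (fun _ => _) =
    (fun x : R => \sum_(1 <= j < J.+1) x ^+ j / j%:R) + (J.+1%:R^-1 \*: (id ^+ J.+1))).
  apply: is_deriveD.
  rewrite (_ : t ^+ J = J.+1%:R^-1 *: ((J.+1%:R * t ^+ J) *: 1)).
    by apply: is_deriveZ; apply: (@is_deriveX R R id J.+1 t 1 1).
  by rewrite scalerA mulrA mulVf ?mul1r ?pnatr_eq0// /GRing.scale/= mulr1.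
by apply/funext => x; rewrite big_nat_recr//= !fctE mulrC.
Qed.

(** Mean value theorem on [[0, y]]: the middle expression has derivative [- x^J / (1 - x)], and
    [1 / (1 - x) <= 2] there. *)
Lemma ln_log_series J y : 0 < y <= 2^-1 ->
  - (2 * y ^+ J.+1) <= ln (1 - y) + \sum_(1 <= j < J.+1) y ^+ j / j%:R <= 0.
Proof.
move=> /andP[y0 y2].
pose f (x : R) := ln (1 - x) + \sum_(1 <= j < J.+1) x ^+ j / j%:R.
have df (x : R) : x < 1 -> is_derive x 1 f (- (x ^+ J / (1 - x))).
  move=> x1.
  have -> : - (x ^+ J / (1 - x)) = - (1 - x)^-1 + \sum_(j < J) x ^+ j.
    have H : 1 - x != 0 by rewrite gt_eqF// subr_gt0.
    apply: (mulIf H); rewrite mulrDl !mulNr divfK// mulVf// mulrC.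
    by rewrite -[1 - x]opprB mulNr -subrX1 opprB addrA addNr add0r.
  apply: is_deriveD; last exact: is_derive_log_series.
  have := @is_derive1_comp R (@ln R) (fun x => 1 - x) x (1 - x)^-1 (-1).
  rewrite mulrN1; apply.
    by apply: is_derive1_ln; rewrite subr_gt0.
  rewrite -[X in is_derive _ _ _ X]add0r; apply: is_deriveB.
have cf : {within `[0, y], continuous f}.
  apply: derivable_within_continuous => x; rewrite in_itv/= => /andP[_ xy].
  have x1 : x < 1 by apply: le_lt_trans xy _; lra.
  by have [] := df _ x1.
have hd (x : R) : x \in `]0, y[ -> is_derive x 1 f (- (x ^+ J / (1 - x))).
  rewrite in_itv/= => /andP[_ xy]; apply: df; apply: lt_trans xy _; lra.
have [c] := MVT y0 hd cf; rewrite in_itv/= => /andP[c0 cy].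
have -> : f 0 = 0.
  rewrite /f subr0 ln1 add0r big_nat_cond big1// => j /andP[/andP[j0 _] _].
  by rewrite expr0n gtn_eqF// mul0r.
rewrite subr0 subr0 -/(f y) => ->.
have c1 : 2^-1 <= 1 - c by lra.
have c1' : 0 < 1 - c by lra.
have cJ : 0 <= c ^+ J by rewrite exprn_ge0// ltW.
have H : 0 <= c ^+ J / (1 - c) by rewrite divr_ge0// ltW.
rewrite mulNr oppr_le0 mulr_ge0 ?(ltW y0)// andbT lerN2 exprSr mulrA ler_pM2r//.
rewrite ler_pdivrMr// mulrC mulrA.
have cyJ : c ^+ J <= y ^+ J by rewrite lerXn2r// ?nnegrE ltW.
nra.
Qed.
End LogSeries.

Section Recursion.
Variables (F : finFieldType) (R : realType).
Local Notation q := (#|F|%:R : R).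
Local Notation s := (Num.sqrt (#|F|%:R : R)).
Local Notation a n m := (rough_prop F R n m).
Local Notation b := (logder_coef F R).
Local Notation G m := (sieve_poly F R m).

(** Gauss' formula in normalised form. No polynomial of degree between [1] and [m] is rough, so the
    coefficients of [sieve_poly m] up to degree [m] are [1, -1, 0, ..., 0]; for [i >= 2] the
    recursion reduces to [b i = b (i - 1)]. *)
Lemma logder_coef_eq1 m i : (0 < i <= m)%N -> b m i = 1.
Proof.
have aS j : (j < m)%N -> a j.+1 m = 0 by move=> jm; apply: rough_prop_eq0.
elim: i => [|[|i] IH]; first by [].
  move=> /= m0; have := sieve_poly_recursion F R m 1.
  rewrite big_nat1 sieve_poly_coefS aS// rough_prop0 sieve_poly0 mul1r sub0r mulr1.
  by move=> /oppr_inj.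
move=> /= im; have := sieve_poly_recursion F R m i.+2.
rewrite sieve_poly_coefS !aS ?(ltnW im)// subrr mulr0 big_nat_recr//= subnn.
rewrite sieve_poly0 mulr1 big_nat_recr//= subSnn sieve_poly_coefS rough_prop0.
rewrite aS ?(leq_ltn_trans _ im)// IH ?(ltnW im)// sub0r mul1r.
rewrite big_nat_cond big1 ?add0r => [|j /andP[/andP[j0 ji] _]].
  by move/esym/eqP; rewrite oppr_eq0 addrC subr_eq0 => /eqP.
have [k ek] : exists k, (i.+2 - j = k.+2)%N by exists (i - j)%N; lia.
by rewrite ek sieve_poly_coefS !aS ?subrr ?mulr0//; lia.
Qed.

Lemma card_field_exp_ge0 i : 0 <= q ^- i.
Proof. by rewrite invr_ge0 exprn_ge0. Qed.

Lemma num_irred_le k : (0 < k)%N -> (k * num_irred F k <= #|F| ^ k)%N.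
Proof.
move=> k0; rewrite -(ler_nat R) natrX.
have qk : 0 < q ^+ k by rewrite exprn_gt0// card_field_gt0.
rewrite -[leRHS]mul1r -ler_pdivrMr// mulrC.
apply: (@le_trans _ _ (b k k)); last by rewrite logder_coef_eq1// k0 leqnn.
rewrite /logder_coef ler_wpM2l ?card_field_exp_ge0// ler_nat.
rewrite [leqRHS]big_mkcond big_nat_recr//= dvdnn.
exact: leq_addl.
Qed.

Lemma logder_coef_ge0 m i : 0 <= b m i.
Proof. by rewrite mulr_ge0// card_field_exp_ge0. Qed.

(** Since [q >= 2]; the value [4 / 3] gives the ratio [3 / 4] accepted by [geometric_tail]. *)
Lemma sqrt_card_gt : 4 / 3 <= s.
Proof.
have q2 : 2 <= q by rewrite ler_nat; exact: card_finNzRing_gt1.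
have s2 : s ^+ 2 = q by rewrite sqr_sqrtr// ler0n.
have : 0 <= s by exact: sqrtr_ge0.
nra.
Qed.

Lemma sqrt_card_gt0 : 0 < s.
Proof. by apply: lt_le_trans sqrt_card_gt; lra. Qed.

(** A divisor [k <= m] of [i > m] is proper, hence at most [i / 2]; by [num_irred_le] the sum is at
    most [sum_(k <= i/2) q^k <= 2 q^(i/2)]. *)
Lemma logder_coef_le m i : (m < i)%N -> b m i <= 2 * s ^- i.
Proof.
move=> mi; have q2 : (1 < #|F|)%N by exact: card_finNzRing_gt1.
have geo h : (\sum_(1 <= k < h.+1) #|F| ^ k <= 2 * #|F| ^ h)%N.
  elim: h => [|h IH]; first by rewrite big_geq.
  rewrite big_nat_recr//= expnS mul2n -addnn leq_add2r (leq_trans IH)//.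
  by rewrite leq_mul2r q2 orbT.
set h := i./2.
have le_h : (\sum_(1 <= k < m.+1 | (k %| i)%N) k * num_irred F k <=
              2 * #|F| ^ h)%N.
  apply: leq_trans (geo h).
  rewrite (big_nat_widen 1 m.+1 i.+1) ?(leqW mi)// (big_nat_widen 1 h.+1 i.+1); last first.
    by rewrite ltnS /h -divn2 leq_div.
  rewrite big_mkcond [leqRHS]big_mkcond/=.
  apply: (@big_ind2 _ _ (fun x y => (x <= y)%N)) => //; first by move=> *; exact: leq_add.
  move=> k _; case: ifP => // /andP[/dvdnP[[|[|c]] ec] km].
  - lia.
  - lia.
  have k0 : (0 < k)%N by lia.
  have -> : (k < h.+1)%N by rewrite ltnS /h; lia.
  exact: num_irred_le.
have s2 : s ^+ 2 = q by rewrite sqr_sqrtr// ler0n.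
have s1 : 1 <= s by apply: le_trans sqrt_card_gt; lra.
have s0 := sqrt_card_gt0.
rewrite /logder_coef; apply: (@le_trans _ _ (q ^- i * (2 * q ^+ h))).
  by rewrite ler_wpM2l ?card_field_exp_ge0// -natrX -natrM ler_nat.
rewrite mulrCA ler_pM2l//.
move: s s2 s1 s0 => t s2 s1 s0.
rewrite -s2 -!exprM ler_pdivrMl ?exprn_gt0//.
rewrite ler_pdivlMr ?exprn_gt0// -exprD ler_weXn2l// /h; lia.
Qed.

Lemma geometric_tail (r : R) k N : 0 <= r <= 3 / 4 ->
  \sum_(k <= i < N) r ^+ i <= 4 * r ^+ k.
Proof.
move=> /andP[r0 r1].
(* The subtracted term makes the induction on [N] work, as [r <= 3/4] gives
   [r^N <= 4 r^N - 4 r^(N+1)]. *)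
suff : (k <= N)%N -> \sum_(k <= i < N) r ^+ i <= 4 * r ^+ k - 4 * r ^+ N.
  have [kN /(_ isT) H|/ltnW Nk _] := leqP k N.
    by rewrite (le_trans H)// gerBl mulr_ge0// exprn_ge0.
  by rewrite big_geq// mulr_ge0// exprn_ge0.
elim: N => [|N IH].
  by rewrite leqn0 => /eqP ->; rewrite big_geq// subrr.
rewrite leq_eqVlt => /predU1P[->|kN]; first by rewrite big_geq// subrr.
rewrite big_nat_recr//=; have := IH kN; have : 0 <= r ^+ N by rewrite exprn_ge0.
by rewrite exprSr; nra.
Qed.

Lemma sum_logder_coef_le m N :
  \sum_(m.+1 <= i < N) b m i <= 8 * s ^- m.+1.
Proof.
apply: (@le_trans _ _ (\sum_(m.+1 <= i < N) 2 * s^-1 ^+ i)).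
  by apply: ler_sum_nat => i /andP[mi _]; rewrite exprVn logder_coef_le.
rewrite -mulr_sumr (_ : 8 * s ^- m.+1 = 2 * (4 * s^-1 ^+ m.+1)); last first.
  by rewrite mulrA -natrM exprVn.
have s0 := sqrt_card_gt0; have s1 := sqrt_card_gt.
rewrite ler_pM2l// geometric_tail// invr_ge0 (ltW s0)/=.
by rewrite invf_ple ?posrE//; lra.
Qed.

Definition tail_error (n m : nat) : R :=
  \sum_(m.+1 <= i < n.+1) b m i * (G m)`_(n - i).

(** For [i <= m] the coefficients [b m i] equal [1], so these terms telescope to a difference of two
    proportions. *)
Lemma rough_prop_recursion n m : (m <= n)%N ->
  n.+1%:R * (a n.+1 m - a n m) = a (n - m) m - a n m - tail_error n.+1 m.
Proof.
move=> mn; rewrite -sieve_poly_coefS sieve_poly_recursion.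
rewrite (@big_cat_nat _ _ _ m.+1)//=; last by rewrite !ltnS leqW.
rewrite opprD -/(tail_error n.+1 m); congr (_ - _).
rewrite (eq_big_nat _ _ (F2 := fun i => - (a (n.+1 - i.+1) m - a (n.+1 - i) m))); last first.
  move=> i /andP[i0 im]; rewrite logder_coef_eq1 ?mul1r ?i0// opprB.
  rewrite (_ : (n.+1 - i = (n.+1 - i.+1).+1)%N) ?sieve_poly_coefS//; lia.
by rewrite sumrN opprK telescope_sumr// subn1.
Qed.

(** Every coefficient of [sieve_poly m] has modulus at most [1], being [1] or a difference of two
    proportions. *)
Lemma tail_error_le n m : `|tail_error n m| <= 8 * s ^- m.+1.
Proof.
apply: le_trans (sum_logder_coef_le m n.+1).
apply: le_trans (ler_norm_sum _ _ _) _.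
apply: ler_sum_nat => i _; rewrite normrM ger0_norm ?logder_coef_ge0//.
rewrite ler_piMr ?logder_coef_ge0//; case: (n - i)%N => [|j].
  by rewrite sieve_poly0 normr1.
rewrite sieve_poly_coefS; have := rough_prop_ge0 F R j.+1 m.
have := rough_prop_le1 F R j.+1 m; have := rough_prop_ge0 F R j m.
have := rough_prop_le1 F R j m.
by rewrite ler_norml; move=> *; apply/andP; split; lra.
Qed.

End Recursion.

(** * The product lambda and Euler's constant *)

Section Lambda.
Variables (F : finFieldType) (R : realType).
Local Notation q := (#|F|%:R : R).
Local Notation s := (Num.sqrt (#|F|%:R : R)).
Local Notation b := (logder_coef F R).

Lemma sum_multiples (f : nat -> R) k J : (0 < k)%N ->
  \sum_(1 <= j < J.+1) f (k * j)%N = \sum_(1 <= i < (k * J).+1 | (k %| i)%N) f i.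
Proof.
move=> k0; rewrite [RHS]big_mkcond/=; elim: J => [|J IH].
  by rewrite muln0 !big_geq.
rewrite big_nat_recr//= IH [RHS](@big_cat_nat _ _ _ (k * J).+1)//=; last first.
  by rewrite ltnS leq_mul2l leqnSn orbT.
congr (_ + _); rewrite big_nat_recr/=; last by rewrite ltn_pmul2l.
rewrite dvdn_mulr// big_nat_cond big1 ?add0r// => i /andP[/andP[i1 i2] _].
case: ifP => // /dvdnP[c ec]; move: i1 i2; rewrite ec [(c * k)%N]mulnC !ltn_pmul2l//.
by rewrite ltnS => /leq_trans H /H; rewrite ltnn.
Qed.

Let y k : R := q ^- k.

Let y_bounds k : (0 < k)%N -> 0 < y k <= 2^-1.
Proof.
move=> k0; have q2 : 2 <= q by rewrite ler_nat; exact: card_finNzRing_gt1.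
rewrite invr_gt0 exprn_gt0/= ?card_field_gt0// lef_pV2 ?posrE ?exprn_gt0 ?card_field_gt0//.
by rewrite (le_trans q2)// -[leLHS]expr1 ler_weXn2l//; lra.
Qed.

(** A truncation of [- ln lambda] ordered by the total exponent [i], where Gauss' formula applies.
    [M] below truncates the logarithm of each factor instead; [M_le] and [M_ge] sandwich one by the
    other. *)
Let T m N : R := \sum_(1 <= i < N.+1) b m i / i%:R.

Let T_swap m N : T m N = \sum_(1 <= k < m.+1) (num_irred F k)%:R *
   \sum_(1 <= i < N.+1 | (k %| i)%N) (k%:R * (q ^- i / i%:R)).
Proof.
under eq_bigr do rewrite mulr_sumr.
under eq_bigr do rewrite big_mkcond/=.
rewrite exchange_big_nat/=; apply: eq_bigr => i _.
rewrite /logder_coef natr_sum -big_mkcond/= mulrAC mulr_sumr; apply: eq_bigr => k _.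
by rewrite natrM mulrCA mulrA [RHS]mulrC mulrA.
Qed.

Let M m J : R := \sum_(1 <= k < m.+1) (num_irred F k)%:R *
  \sum_(1 <= j < J.+1) (y k ^+ j / j%:R).

Let M_multiples m J : M m J = \sum_(1 <= k < m.+1) (num_irred F k)%:R *
   \sum_(1 <= i < (k * J).+1 | (k %| i)%N) (k%:R * (q ^- i / i%:R)).
Proof.
apply: eq_big_nat => k /andP[k0 _]; congr (_ * _); rewrite -sum_multiples//.
apply: eq_big_nat => j /andP[j0 _]; rewrite /y exprVn -exprM natrM invfM.
by rewrite [RHS]mulrCA mulVKf// pnatr_eq0 -lt0n.
Qed.

Let le_sum_upto (f : nat -> R) (P : pred nat) N N' : (forall i, 0 <= f i) ->
  (N <= N')%N -> \sum_(1 <= i < N.+1 | P i) f i <= \sum_(1 <= i < N'.+1 | P i) f i.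
Proof.
move=> f0 NN; rewrite [leRHS](@big_cat_nat _ _ _ N.+1)//= lerDl.
by apply: sumr_ge0.
Qed.

Let term_ge0 (k i : nat) : 0 <= (k%:R * (q ^- i / i%:R) : R).
Proof. by rewrite !mulr_ge0// ?invr_ge0// exprn_ge0. Qed.

Let M_le m J : M m J <= T m (m * J).
Proof.
rewrite M_multiples T_swap; apply: ler_sum_nat => k /andP[_ km].
by rewrite ler_wpM2l// le_sum_upto// leq_mul2r -ltnS km orbT.
Qed.

Let M_ge m J : T m J <= M m J.
Proof.
rewrite M_multiples T_swap; apply: ler_sum_nat => k /andP[k0 _].
by rewrite ler_wpM2l// le_sum_upto// leq_pmull.
Qed.

Let T_ge m N : (m <= N)%N -> Hsum R m <= T m N.
Proof.
move=> mN; rewrite /T (@big_cat_nat _ _ _ m.+1)//= ler_wpDr//.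
  by apply: sumr_ge0 => i _; rewrite divr_ge0// logder_coef_ge0.
by apply: ler_sum_nat => i im; rewrite logder_coef_eq1 ?mul1r.
Qed.

Let T_le m N : (0 < m)%N -> T m N <= Hsum R m + 8 / (m%:R * s ^+ m.+1).
Proof.
move=> m0; apply: (@le_trans _ _ (T m (N + m))).
  by apply: le_sum_upto; [move=> i; rewrite divr_ge0// logder_coef_ge0|exact: leq_addr].
rewrite /T (@big_cat_nat _ _ _ m.+1)//=; last by rewrite ltnS leq_addl.
apply: lerD.
  by apply: ler_sum_nat => i im; rewrite logder_coef_eq1 ?mul1r.
apply: (@le_trans _ _ (\sum_(m.+1 <= i < (N + m).+1) b m i / m%:R)).
  apply: ler_sum_nat => i /andP[mi _]; rewrite ler_wpM2l ?logder_coef_ge0//.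
  by rewrite lef_pV2 ?posrE ?ltr0n ?ler_nat//; lia.
rewrite -mulr_suml invfM mulrA [8 / _]mulrC -mulrA mulrC ler_wpM2l ?invr_ge0//.
exact: sum_logder_coef_le.
Qed.

Lemma lambda_bounds m : (0 < m)%N ->
  expR (- (Hsum R m + 8 / (m%:R * s ^+ m.+1))) <= lambda F R m <= expR (- Hsum R m).
Proof.
move=> m0; pose L := \sum_(1 <= k < m.+1) (num_irred F k)%:R * ln (1 - y k).
have -> : lambda F R m = expR L.
  rewrite expR_sum; apply: eq_big_nat => k /andP[k0 _].
  have /andP[_ yk] := y_bounds k0.
  rewrite expRM_natl lnK// posrE; lra.
rewrite !ler_expR; apply/andP; split; last first.
  (* For the upper bound, [m] terms of each logarithm series suffice, because
     [H_m <= T m m <= M m m]. *)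
  rewrite -(lerD2r (M m m)) addrC; apply: (@le_trans _ _ 0).
    rewrite addrC -big_split/=.
    rewrite big_nat_cond; apply: sumr_le0 => k /andP[/andP[k0 _] _].
    rewrite -mulrDr mulr_ge0_le0//.
    by have /andP[_] := ln_log_series m (y_bounds k0).
  rewrite addrC subr_ge0.
  exact: le_trans (T_ge (leqnn m)) (M_ge m m).
(* Truncating after [J + 1] terms or fewer costs at most [W / (J + 1)] in all, as
   [2 y^(J+1) <= 2 / (J + 1)] for each irreducible; [J] is then taken large. *)
pose W : R := \sum_(1 <= k < m.+1) (num_irred F k)%:R * 2.
have W0 : 0 <= W by apply: sumr_ge0 => k _; rewrite mulr_ge0.
apply/ler_addgt0Pr => e e0.
have [J JW] : exists J : nat, W / e < J%:R.
  by exists (Num.bound (W / e)); apply: archi_boundP; rewrite divr_ge0// ltW.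
rewrite lerNl opprD.
have H1 : M m J <= Hsum R m + 8 / (m%:R * s ^+ m.+1).
  exact: le_trans (M_le m J) (T_le _ m0).
suff H2 : - (W / J.+1%:R) <= L + M m J.
  have H3 : W / J.+1%:R <= e.
    rewrite ler_pdivrMr// -ler_pdivrMl// mulrC.
    by rewrite (le_trans (ltW JW))// ler_nat.
  move: H1 H2 H3; move: (8 / _) (W / _) (M m J) => E V X; lra.
rewrite /L /M -big_split/= /W mulr_suml -sumrN.
apply: ler_sum_nat => k /andP[k0 _]; rewrite -mulrDr -mulrA -mulrN ler_wpM2l//.
have /andP[H _] := ln_log_series J (y_bounds k0).
apply: le_trans H; rewrite lerN2 ler_pM2l//.
have /andP[yk0 yk1] := y_bounds k0.
apply: (@le_trans _ _ (2^-1 ^+ J.+1)).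
  by rewrite lerXn2r ?nnegrE// ltW.
by rewrite exprVn lef_pV2 ?posrE ?exprn_gt0// -natrX ler_nat ltnW// ltn_expl.
Qed.

End Lambda.

(** * Monotone approximation of Euler's constant *)

Section EulerGamma.
Variable R : realType.
Local Notation e := (fun m : nat => Hsum R m - @ln R m%:R).

Lemma HsumS m : Hsum R m.+1 = Hsum R m + m.+1%:R^-1.
Proof. by rewrite /Hsum big_nat_recr. Qed.

Lemma ln_succ_bounds m : (0 < m)%N ->
  (m.+1%:R^-1 : R) <= @ln R m.+1%:R - ln m%:R <= m%:R^-1.
Proof.
move=> m0; have m0' : 0 < (m%:R : R) by rewrite ltr0n.
have m1 : 0 < (m.+1%:R : R) by rewrite ltr0n.
rewrite -ln_div ?posrE//; apply/andP; split.
  rewrite -lerN2 -lnV ?posrE ?divr_gt0// invf_div.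
  have -> : m%:R / m.+1%:R = 1 + - m.+1%:R^-1 :> R.
    by rewrite -natr1; field; rewrite natr1 pnatr_eq0.
  by rewrite le_ln1Dx// ltrN2 invf_lt1// ltr1n.
have -> : m.+1%:R / m%:R = 1 + m%:R^-1 :> R.
  by rewrite -natr1 mulrDl divff ?gt_eqF// div1r.
by rewrite le_ln1Dx// (lt_trans (ltrN10 R))// invr_gt0.
Qed.

(** [e] decreases, while [l] increases and stays below it; the limit lies between them, and they
    differ by at most [1 / m]. *)
Lemma euler_gamma_bounds m : (0 < m)%N ->
  euler_gamma R <= e m <= euler_gamma R + m%:R^-1.
Proof.
(* [e'] starts at index [1], which keeps [ln 0] out of the monotone sequence. *)
pose e' (n : nat) := e n.+1; pose l (n : nat) := Hsum R n - @ln R n.+1%:R.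
have de : nonincreasing_seq e'.
  apply/nonincreasing_seqP => n; rewrite /e' /= HsumS.
  have /andP[+ _] := @ln_succ_bounds n.+1 isT.
  by move: (n.+2%:R^-1) => x; lra.
have dl : nondecreasing_seq l.
  apply/nondecreasing_seqP => n; rewrite /l /= HsumS.
  have /andP[_] := @ln_succ_bounds n.+1 isT.
  by move: (n.+1%:R^-1) => x; lra.
have le n : l n <= e' n.
  have : 0 <= (n.+1%:R^-1 : R) by [].
  by rewrite /l /e' /= HsumS; move: (n.+1%:R^-1) => x; lra.
have l_le n k : l n <= e' k.
  have [nk|/ltnW kn] := leqP n k; first exact: le_trans (dl _ _ nk) (le k).
  exact: le_trans (le n) (de _ _ kn).
have ce' : cvgn e'.
  apply: nonincreasing_is_cvgn => //; exists (l 0%N) => _ [n _ <-]; exact: l_le.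
have lim_e : limn e' = euler_gamma R.
  apply/esym; apply: cvg_lim => //; rewrite -cvg_shiftS/=; exact: ce'.
case: m => // m _; rewrite -lim_e; apply/andP; split.
  exact: nonincreasing_cvgn_ge.
have ll : l m.+1 <= limn e' by apply: limr_ge => //; near=> n; exact: l_le.
move: ll; rewrite /l.
have /andP[_] := @ln_succ_bounds m.+1 isT.
by move: (m.+1%:R^-1) => x; lra.
Unshelve. all: by end_near. Qed.

End EulerGamma.

(** * Bounds for Buchstab's function *)

Section Entropy.
Variable R : realType.
Implicit Types u v : R.

(* [u ^ - u] and [(u / e) ^ - u], for [u > 0]; see [invself_eP]. *)
Definition invself u : R := expR (- (u * ln u)).
Definition invself_e u : R := expR (u - u * ln u).

Lemma ln_sub_le u v : 0 < u -> 0 < v -> v * (ln u - ln v) <= u - v.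
Proof.
move=> u0 v0; rewrite -ln_div ?posrE//.
have -> : u / v = 1 + (u / v - 1) by rewrite addrC subrK.
have uv : 0 < u / v by rewrite divr_gt0.
have : ln (1 + (u / v - 1)) <= u / v - 1 by apply: le_ln1Dx; lra.
rewrite -(ler_pM2l v0) => /le_trans; apply.
by rewrite mulrBr mulr1 mulrCA divff ?gt_eqF// mulr1.
Qed.

(** Convexity of [u ln u], whose derivative is [1 + ln u]. *)
Lemma mul_ln_bounds v u : 0 < v -> v <= u ->
  (u - v) * (1 + ln v) <= u * ln u - v * ln v <= (u - v) * (1 + ln u).
Proof.
move=> v0 vu; have u0 : 0 < u by apply: lt_le_trans vu.
by have := ln_sub_le u0 v0; have := ln_sub_le v0 u0; nra.
Qed.

Lemma invself_gt0 u : 0 < invself u. Proof. exact: expR_gt0. Qed.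

Lemma invself_e_gt0 u : 0 < invself_e u. Proof. exact: expR_gt0. Qed.

Lemma invself_nincr v u : 1 <= v -> v <= u -> invself u <= invself v.
Proof.
move=> v1 vu; rewrite ler_expR lerN2.
have v0 : 0 < v by lra.
by have /andP[+ _] := mul_ln_bounds v0 vu; have := ln_ge0 v1; nra.
Qed.

Lemma invself_e_nincr v u : 1 <= v -> v <= u -> invself_e u <= invself_e v.
Proof.
move=> v1 vu; rewrite ler_expR.
have v0 : 0 < v by lra.
by have /andP[+ _] := mul_ln_bounds v0 vu; have := ln_ge0 v1; nra.
Qed.

Lemma invself_sub1 u : 1 < u -> invself (u - 1) <= expR 1 * u * invself u.
Proof.
move=> u1; have u0 : 0 < u by lra.
rewrite -{2}(lnK u0) -!expRD ler_expR.
have H1 : 0 < u - 1 by lra.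
have H2 : u - 1 <= u by lra.
have /andP[_ ] := mul_ln_bounds H1 H2.
by rewrite (_ : u - (u - 1) = 1) ?mul1r; lra.
Qed.

Lemma invself_eE u : invself_e u = expR u * invself u.
Proof. by rewrite -expRD. Qed.

Lemma invself_eP u : 0 < u -> (u / expR 1) `^ (- u) = invself_e u.
Proof.
move=> u0; have H : 0 < u / expR 1 by rewrite divr_gt0// expR_gt0.
rewrite /powR gt_eqF// lnM ?posrE ?invr_gt0 ?expR_gt0// lnV ?posrE ?expR_gt0//.
by rewrite expRK; congr expR; ring.
Qed.

Lemma is_derive_invself u : 0 < u -> is_derive u 1 invself (- ((1 + ln u) * invself u)).
Proof.
move=> u0; have -> : - ((1 + ln u) * invself u) = invself u * (- (u * u^-1 + ln u)).
  by rewrite divff ?gt_eqF//; ring.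
apply: (@is_derive1_comp _ (@expR R) (fun u => - (u * ln u))).
apply: is_deriveN.
have -> : u / u + ln u = u *: u^-1 + ln u *: 1 by rewrite /GRing.scale/= mulr1.
have := is_derive1_ln u0; exact: is_deriveM.
Qed.

Lemma expR1_le4 : expR 1 <= 4 :> R.
Proof.
have -> : (1 : R) = 2%:R * 2^-1 by rewrite divff.
rewrite expRM_natl.
have : 1 + - 2^-1 <= expR (- 2^-1) :> R by exact: expR_ge1Dx.
rewrite expRN => H; have e0 : 0 < expR (2^-1 : R) by exact: expR_gt0.
have : expR (2^-1 : R) <= 2.
  by have := ler_wpM2l (ltW e0) H; rewrite divff ?gt_eqF//; lra.
by rewrite expr2; nra.
Qed.

(** As [64 = 4^3 >= e^3]. This provides [1 + ln u >= 4 >= e] in [dbuchstab_bound], and in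
    [model_error_decay] a gain of [3] against a loss of [2]. *)
Lemma ln_ge3 u : 64 <= u -> 3 <= ln u.
Proof.
move=> u64; rewrite -ler_expR lnK ?posrE; last by lra.
have -> : (3 : R) = 3%:R * 1 by rewrite mulr1.
rewrite expRM_natl; apply: le_trans u64; have -> : (64 : R) = 4 ^+ 3 by lra.
by rewrite lerXn2r ?nnegrE ?expR_ge0// expR1_le4.
Qed.

End Entropy.

(** * Size and decay of Buchstab's function and of its derivative *)

Section Buchstab.
Variable R : realType.
Implicit Types u v : R.
Local Notation w := (@buchstab R).

Lemma buchstab_inv u : 1 <= u <= 2 -> w u = u^-1.
Proof. by have [_ H _ _] := buchstabP R; exact: H. Qed.

Lemma buchstab_increment v u : 2 <= v -> v < u ->
  exists2 c, v < c < u & u * w u - v * w v = w (c - 1) * (u - v).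
Proof.
have [_ _ wc wd] := buchstabP R.
move=> v2 vu; pose f (t : R) : R := t * w t.
have df x : x \in `]v, u[ -> is_derive x 1 f (w (x - 1)).
  by rewrite in_itv/= => /andP[vx _]; apply: wd; lra.
have sub : `[v, u] `<=` `[1, +oo[.
  by move=> x /=; rewrite !in_itv/= andbT => /andP[x2 _]; lra.
have fc : {within `[v, u], continuous f}.
  move=> x; apply: cvgM; first exact: (continuous_subspaceT (fun=> cvg_id)).
  exact: (continuous_subspaceW sub wc).
have [c] := MVT vu df fc; rewrite in_itv/= => cvu e.
by exists c.
Qed.

(** Induction over unit intervals: by [buchstab_increment], [w u] is a convex combination of two
    earlier values, with weights [v / u] and [(u - v) / u]. *)
Lemma buchstab_bounds u : 1 <= u -> 2^-1 <= w u <= 1.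
Proof.
move=> u1; suff H k : forall u, 1 <= u -> u <= k.+2%:R -> 2^-1 <= w u <= 1.
  apply: (H (Num.bound u)) => //; rewrite (le_trans (ltW (archi_boundP _)))//; first by lra.
  by rewrite ler_nat; apply: leq_trans (leqnSn _).
elim: k => [|k IH] {u1}{}u u1 uk.
  rewrite buchstab_inv ?u1//; have u0 : 0 < u by lra.
  rewrite lef_pV2 ?posrE// ?invf_le1//; lra.
have [u2|u2] := leP u k.+2%:R; first exact: IH.
have k2 : 2 <= k.+2%:R :> R by rewrite ler_nat.
have [c /andP[c1 c2] e] := buchstab_increment k2 u2.
have uk' : u <= k.+2%:R + 1 by rewrite natr1.
move: k2 uk' u2 c1 c2 e IH; move: (k.+2%:R : R) => v k2 uk' u2 c1 c2 e IH.
have /andP[a1 a2] : 2^-1 <= w (c - 1) <= 1 by apply: IH; lra.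
have /andP[b1 b2] : 2^-1 <= w v <= 1 by apply: IH; lra.
have u0 : 0 < u by lra.
have e' : u * w u = v * w v + w (c - 1) * (u - v) by rewrite -e; lra.
by apply/andP; split; rewrite -(ler_pM2l u0) e'; nra.
Qed.

Definition dbuchstab u : R := (w (u - 1) - w u) / u.

Lemma is_derive_buchstab u : 2 < u -> is_derive u 1 w (dbuchstab u).
Proof.
move=> u2; have [_ _ _ wd] := buchstabP R.
have u0 : u != 0 by rewrite gt_eqF//; lra.
apply: (@near_eq_is_derive R R R ((fun t => t * w t) * (fun t => t^-1))).
  near=> t; rewrite fctE/= mulrC mulKf// gt_eqF//.
  by near: t; apply: lt_nbhsr; lra.
have -> : dbuchstab u = (u * w u) *: (- u ^- 2 *: 1) + u^-1 *: w (u - 1).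
  by rewrite /GRing.scale/= /dbuchstab; field.
apply: is_deriveM; first exact: wd.
by apply: is_deriveV.
Unshelve. all: by end_near. Qed.

Lemma buchstab_cont u : 2 < u -> {for u, continuous w}.
Proof.
move=> u2; apply: differentiable_continuous; apply/derivable1_diffP.
by have [] := is_derive_buchstab u2.
Qed.

Lemma dbuchstab_le1 u : 2 <= u -> `|dbuchstab u| <= 1.
Proof.
move=> u2; have u0 : 0 < u by lra.
rewrite normrM normfV (gtr0_norm u0) ler_pdivrMr// mul1r.
have /andP[? ?] : 2^-1 <= w (u - 1) <= 1 by apply: buchstab_bounds; lra.
have /andP[? ?] : 2^-1 <= w u <= 1 by apply: buchstab_bounds; lra.
by rewrite ler_norml; apply/andP; split; lra.
Qed.

Lemma buchstab_MVT v u : 2 <= v -> v < u ->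
  exists2 c, v < c < u & w u - w v = dbuchstab c * (u - v).
Proof.
have [_ _ wc _] := buchstabP R.
move=> v2 vu; have df x : x \in `]v, u[ -> is_derive x 1 w (dbuchstab x).
  by rewrite in_itv/= => /andP[vx _]; apply: is_derive_buchstab; lra.
have sub : `[v, u] `<=` `[1, +oo[.
  by move=> x /=; rewrite !in_itv/= andbT => /andP[x2 _]; lra.
have [c] := MVT vu df (continuous_subspaceW sub wc).
by rewrite in_itv/= => cvu e; exists c.
Qed.

(** The two sides of [2] are treated apart, because the one-sided derivatives differ there: [-1/4]
    on the left, [1/4] on the right. *)
Lemma buchstab_lipschitz v u : 1 <= v -> v <= u -> `|w u - w v| <= u - v.
Proof.
have low x y : 1 <= x -> x <= y -> y <= 2 -> `|w y - w x| <= y - x.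
  move=> x1 xy y2; rewrite !buchstab_inv; [|lra..].
  have x0 : x != 0 by rewrite gt_eqF//; lra.
  have y0 : y != 0 by rewrite gt_eqF//; lra.
  have -> : y^-1 - x^-1 = - ((y - x) / (x * y)) by field; rewrite ?x0 ?y0.
  rewrite normrN ger0_norm; last by rewrite divr_ge0//; nra.
  have xy1 : 1 <= x * y by nra.
  by rewrite ler_pdivrMr ?(lt_le_trans ltr01 xy1)// ler_peMr// subr_ge0.
have high x y : 2 <= x -> x <= y -> `|w y - w x| <= y - x.
  move=> x2; rewrite le_eqVlt => /predU1P[->|xy]; first by rewrite !subrr normr0.
  have [c /andP[xc cy] ->] := buchstab_MVT x2 xy.
  rewrite normrM [`|y - x|]gtr0_norm ?subr_gt0// -[leRHS]mul1r ler_wpM2r//; first lra.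
  by apply: dbuchstab_le1; lra.
move=> v1 vu; have [u2|/ltW u2] := leP u 2; first exact: low.
have [v2|/ltW v2] := leP 2 v; first exact: high.
have -> : w u - w v = (w u - w 2) + (w 2 - w v) by lra.
rewrite (le_trans (ler_normD _ _))//.
by have := high 2 u (lexx _) u2; have := low v 2 v1 v2 (lexx _); lra.
Qed.

(* The candidate majorant [(1 + ln c) * invself c] of [|dbuchstab c|] is minus the derivative of
   [invself]. *)
Lemma buchstab_diff_le M v u : 2 <= v -> v <= u ->
  (forall c, v < c < u -> `|dbuchstab c| <= M * ((1 + ln c) * invself c)) ->
  `|w u - w v| <= M * (invself v - invself u).
Proof.
move=> v2 vu dM; move: vu; rewrite le_eqVlt => /predU1P[->|vu].
  by rewrite !subrr normr0 mulr0.
have aux (k : R) : `|k| <= 1 -> k * (w u - w v) <= M * (invself v - invself u).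
  move=> k1; pose f := (k \*: w) + (M \*: @invself R).
  pose df c := k *: dbuchstab c + M *: (- ((1 + ln c) * invself c)).
  have hd (c : R) : 2 < c -> is_derive c 1 f (df c).
    move=> c2; apply: is_deriveD; apply: is_deriveZ; first exact: is_derive_buchstab.
    by apply: is_derive_invself; lra.
  have hd' (c : R) : c \in `]v, u[ -> is_derive c 1 f (df c).
    by rewrite in_itv/= => /andP[vc _]; apply: hd; lra.
  have fc : {within `[v, u], continuous f}.
    have [_ _ wc _] := buchstabP R.
    have sub : `[v, u] `<=` `[1, +oo[.
      by move=> x /=; rewrite !in_itv/= andbT => /andP[x2 _]; lra.
    move=> x; apply: cvgD; apply: cvgZr.
      exact: (continuous_subspaceW sub wc).
    have : {within `[v, u], continuous (@invself R)}; last exact.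
    apply: derivable_within_continuous => y; rewrite in_itv/= => /andP[vy _].
    have y0 : 0 < y by lra.
    by have [] := is_derive_invself y0.
  have [c] := MVT vu hd' fc; rewrite in_itv/= => cvu e.
  have : f u - f v <= 0.
    rewrite e mulr_le0_ge0 ?subr_ge0 ?(ltW vu)//.
    have := dM c cvu; rewrite /df /GRing.scale/= mulrN subr_le0; apply: le_trans.
    by rewrite (le_trans (ler_norm _))// normrM ler_piMl.
  have E x : f x = k * w x + M * invself x by [].
  by rewrite !E; lra.
rewrite ler_norml lerNl -mulN1r aux ?normrN1//=.
by rewrite -[w u - w v]mul1r aux ?normr1.
Qed.

(** Induction over unit intervals, by contradiction at a point [c] where the ratio [g] of [|w'|] to
    its majorant is maximal: integrating the bound over [[c - 1, c]] and dividing by [c] gives a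
    strictly smaller ratio. *)
Lemma dbuchstab_bound : exists2 C : R, 0 < C &
  forall u, 2 <= u -> `|dbuchstab u| <= C * ((1 + ln u) * invself u).
Proof.
have mu_gt0 (u : R) : 1 <= u -> 0 < (1 + ln u) * invself u.
  by move=> u1; rewrite mulr_gt0 ?invself_gt0//; have := ln_ge0 u1; lra.
(* Up to [65] the bound [|w'| <= 1] suffices, since the majorant is at least [invself 65] there. *)
pose C := (invself (65 : R))^-1.
have C0 : 0 < C by rewrite invr_gt0 invself_gt0.
exists C => // u u2.
suff H k : forall u, 2 <= u -> u <= 65 + k%:R -> `|dbuchstab u| <= C * ((1 + ln u) * invself u).
  apply: (H (Num.bound u)) => //.
  have u0 : 0 <= u by lra.
  by have := ltW (archi_boundP u0); lra.
elim: k => [|k IH] {u2}{}u u2 uk.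
  apply: le_trans (dbuchstab_le1 u2) _.
  have u1 : 1 <= u by lra.
  rewrite mulrC ler_pdivlMr ?invself_gt0// mul1r.
  have H : invself (65 : R) <= invself u by apply: invself_nincr => //; lra.
  apply: (le_trans H); rewrite ler_peMl ?(ltW (invself_gt0 _))//.
  by have := ln_ge0 u1; lra.
have [u3|u3] := leP u (65 + k%:R); first exact: IH.
pose v : R := 65 + k%:R; have v65 : 65 <= v by rewrite lerDl.
have uv : u <= v + 1 by rewrite /v -addrA natr1.
pose g (x : R) := `|dbuchstab x| / ((1 + ln x) * invself x).
have gc : {within `[v, v + 1], continuous g}.
  apply: continuous_in_subspaceT => x; rewrite inE/= in_itv/= => /andP[vx _].
  have x0 : 0 < x by lra.
  have x1 : 1 <= x by lra.
  have cw : w y @[y --> x] --> w x by apply: buchstab_cont; lra.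
  have cw1 : w (y - 1) @[y --> x] --> w (x - 1).
    apply: (@cvg_comp _ _ _ (fun y => y - 1) w _ (nbhs (x - 1))).

      by apply: cvgB; [exact: cvg_id|exact: cvg_cst].
    by apply: buchstab_cont; lra.
  apply: cvgM.
    apply: cvg_norm; apply: cvgM; first exact: cvgB.
    by apply: cvgV; [rewrite gt_eqF|exact: cvg_id].
  apply: cvgV; first by rewrite gt_eqF// mu_gt0.
  apply: cvgM; first by apply: cvgD; [exact: cvg_cst|exact: continuous_ln].
  apply: differentiable_continuous; apply/derivable1_diffP.
  by have [] := is_derive_invself x0.
have [] := EVT_max _ gc; first lra.
move=> c; rewrite in_itv/= => /andP[vc cv] maxc.
have c1 : 1 <= c by lra.
suff gC : g c <= C.
  rewrite -ler_pdivrMr ?mu_gt0//; last by lra.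
  by apply: le_trans gC; apply: maxc; rewrite in_itv/= uv ltW.
rewrite leNgt; apply/negP => Cg.
have gc0 : 0 < g c by exact: lt_trans C0 Cg.
have dg x : 2 <= x -> x <= v + 1 -> `|dbuchstab x| <= g c * ((1 + ln x) * invself x).
  move=> x2 xv; have x1 : 1 <= x by lra.
  have [xv'|xv'] := leP x v.
    by apply: le_trans (IH x x2 xv') _; rewrite ler_pM2r ?mu_gt0// ltW.
  by rewrite -ler_pdivrMr ?mu_gt0//; apply: maxc; rewrite in_itv/= xv ltW.
(* Strictness comes from dropping [invself c]; then [invself (c - 1) <= e c invself c] and
   [e <= 4 <= 1 + ln c]. *)
have dw : `|w c - w (c - 1)| < g c * (c * ((1 + ln c) * invself c)).
  apply: (@le_lt_trans _ _ (g c * (invself (c - 1) - invself c))).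
    apply: buchstab_diff_le => [||x /andP[x1 x2]]; [lra|lra|].
    by apply: dg; lra.
  rewrite ltr_pM2l//.
  apply: (@lt_le_trans _ _ (invself (c - 1))); first by rewrite gtrBl invself_gt0.
  have c1' : 1 < c by lra.
  apply: le_trans (invself_sub1 c1') _.
  rewrite mulrA ler_pM2r ?invself_gt0// mulrC ler_pM2l; last by lra.
  have c64 : 64 <= c by lra.
  by have := ln_ge3 c64; have := expR1_le4 R; lra.
have e1 : `|dbuchstab c| = `|w c - w (c - 1)| / c.
  by rewrite normrM normfV distrC [`|c|]gtr0_norm//; lra.
have e2 : `|dbuchstab c| = g c * ((1 + ln c) * invself c).
  by rewrite /g divfK// gt_eqF// mu_gt0.
have : `|dbuchstab c| < `|dbuchstab c|; last by rewrite ltxx.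
rewrite {1}e1 e2 ltr_pdivrMr; last by lra.
by rewrite -mulrA [_ * c]mulrC.
Qed.

(** Beyond [2] the derivative bound is integrated. For [v <= 2] the values lie in [[1/2, 1]], and
    the summand [(invself 2)^-1] makes the right side at least [1]. *)
Lemma buchstab_cauchy : exists2 C : R, 0 < C &
  forall v u, 1 <= v -> v <= u -> `|w u - w v| <= C * invself v.
Proof.
have [C C0 HC] := dbuchstab_bound.
have i2 := @invself_gt0 R 2.
exists (C + (invself 2)^-1); first by rewrite addr_gt0// invr_gt0.
move=> v u v1 vu; have [v2|/ltW v2] := leP 2 v.
  apply: (@le_trans _ _ (C * (invself v - invself u))).
    apply: buchstab_diff_le => // c /andP[vc _]; apply: HC; lra.
  have Cu : 0 <= C * invself u by rewrite mulr_ge0// ltW// invself_gt0.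
  have Iv : 0 <= (invself 2)^-1 * invself v by rewrite mulr_ge0// ?invr_ge0 ltW// invself_gt0.
  lra.
have /andP[? ?] := buchstab_bounds v1.
have /andP[? ?] := buchstab_bounds (le_trans v1 vu).
apply: (@le_trans _ _ 1).
  by rewrite ler_norml; apply/andP; split; lra.
rewrite mulrDl ler_wpDl//; first by rewrite mulr_ge0// ltW// invself_gt0.
by rewrite mulrC ler_pdivlMr// mul1r invself_nincr.
Qed.

(** The factor [1 + ln c] is at most [expR c], which turns [c^-c] into [(c/e)^-c]. *)
Lemma buchstab_local : exists2 C : R, 0 < C &
  forall v u, 2 <= v -> v <= u -> `|w u - w v| <= C * (u - v) * invself_e v.
Proof.
have [C C0 HC] := dbuchstab_bound.
exists C => // v u v2; rewrite le_eqVlt => /predU1P[->|vu].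
  by rewrite !subrr normr0 mulr0 mul0r.
have [c /andP[vc cu] ->] := buchstab_MVT v2 vu.
rewrite normrM [`|u - v|]gtr0_norm ?subr_gt0// mulrAC ler_pM2r ?subr_gt0//.
have c2 : 2 <= c by lra.
apply: le_trans (HC c c2) _; rewrite ler_pM2l//.
apply: (@le_trans _ _ (invself_e c)); last by apply: invself_e_nincr; lra.
rewrite invself_eE ler_pM2r ?invself_gt0//.
have -> : ln c = ln (1 + (c - 1)) by rewrite addrC subrK.
have H : -1 < c - 1 by lra.
by have := le_ln1Dx H; have := expR_ge1Dx c; lra.
Qed.

End Buchstab.

(** * Large u *)

Section Rankin.
Variable R : realType.
Implicit Types (f g : {poly R}) (x u : R).

Definition majorizes f g := forall i, `|f`_i| <= g`_i.

Lemma majorizesM f1 g1 f2 g2 :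
  majorizes f1 g1 -> majorizes f2 g2 -> majorizes (f1 * f2) (g1 * g2).
Proof.
move=> h1 h2 i; rewrite !coefM (le_trans (ler_norm_sum _ _ _))//.
by apply: ler_sum => j _; rewrite normrM ler_pM.
Qed.

Lemma majorizes1 : majorizes 1 1.
Proof. by move=> i; rewrite coef1 ger0_norm. Qed.

Lemma majorizesX f g n : majorizes f g -> majorizes (f ^+ n) (g ^+ n).
Proof.
move=> fg; elim: n => [|n IH]; first by rewrite !expr0; exact: majorizes1.
by rewrite !exprS; apply: majorizesM.
Qed.

Lemma majorizes_prod (f g : nat -> {poly R}) m n :
  (forall k, majorizes (f k) (g k)) ->
  majorizes (\prod_(m <= k < n) f k) (\prod_(m <= k < n) g k).
Proof.
move=> fg; apply: (big_ind2 majorizes) => //; first exact: majorizes1.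
by move=> *; exact: majorizesM.
Qed.

(** Rankin's trick: for [i > n] the weight [x^(i - n)] is at least [1]. *)
Lemma majorizes_tail f g x n : majorizes f g -> 1 <= x ->
  `|f.[1] - \sum_(j < n.+1) f`_j| <= x ^- n * g.[x].
Proof.
move=> fg x1; have x0 : 0 < x by lra.
set N := (n.+1 + size f + size g)%N.
have -> : f.[1] = \sum_(0 <= i < N) f`_i.
  rewrite (@horner_coef_wide _ N f 1); last by rewrite /N; lia.
  by rewrite big_mkord; apply: eq_bigr => i _; rewrite expr1n mulr1.
have -> : g.[x] = \sum_(0 <= i < N) g`_i * x ^+ i.
  by rewrite (@horner_coef_wide _ N g x) ?big_mkord// /N; lia.
rewrite -(big_mkord xpredT (fun i => f`_i)).
have nN : (n.+1 <= N)%N by rewrite /N; lia.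
rewrite (@big_cat_nat _ _ _ n.+1 0%N N)//= addrAC subrr add0r.
rewrite (@big_cat_nat _ _ _ n.+1 0%N N)//= mulrDr.
have g0 i : 0 <= g`_i by apply: le_trans (normr_ge0 _) (fg i).
rewrite ler_wpDl//.
  rewrite mulr_ge0// ?invr_ge0 ?exprn_ge0 ?(ltW x0)// sumr_ge0// => i _.
  by rewrite mulr_ge0// exprn_ge0// ltW.
rewrite mulr_sumr (le_trans (ler_norm_sum _ _ _))//.
apply: ler_sum_nat => i /andP[ni _]; rewrite (le_trans (fg i))// mulrCA ler_peMr//.
by rewrite mulrC ler_pdivlMr ?exprn_gt0// mul1r ler_weXn2l// ltnW.
Qed.

(** The majorant is the product of the [(1 + (z/q)^k)^(I_k)]; at [x] each of these is at most
    [expR (x^k / k)], by [1 + y <= e^y] and [I_k <= q^k / k]. *)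
Lemma rough_prop_lambda_rankin (F : finFieldType) x n m : 1 <= x ->
  `|rough_prop F R n m - lambda F R m| <=
    x ^- n * expR (\sum_(1 <= k < m.+1) x ^+ k / k%:R).
Proof.
move=> x1; have x0 : 0 < x by lra.
pose g : {poly R} := \prod_(1 <= k < m.+1) (1 + (#|F|%:R ^- k)%:P * 'X^k) ^+ num_irred F k.
have fg : majorizes (sieve_poly F R m) g.
  apply: majorizes_prod => k; apply: majorizesX => i.
  rewrite coefB coefD coefCM coefXn coef1 (le_trans (ler_normB _ _))//.
  by rewrite !ger0_norm// mulr_ge0// card_field_exp_ge0.
rewrite distrC -sieve_poly1 rough_prop_coef (le_trans (majorizes_tail n fg x1))//.
rewrite ler_wpM2l ?invr_ge0 ?exprn_ge0 ?(ltW x0)//.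
rewrite expR_sum /g horner_prod.
rewrite big_nat_cond [leRHS]big_nat_cond; apply: ler_prod => k /andP[/andP[k0 _] _].
rewrite horner_exp !hornerE; set y := _ * x ^+ k.
have y0 : 0 <= y by rewrite mulr_ge0 ?card_field_exp_ge0// exprn_ge0// ltW.
apply/andP; split; first by rewrite exprn_ge0// addr_ge0.
apply: (@le_trans _ _ (expR y ^+ num_irred F k)).
  by rewrite lerXn2r ?nnegrE ?expR_ge0 ?addr_ge0// expR_ge1Dx.
rewrite -expRM_natl ler_expR /y mulrA [x ^+ k / _]mulrC ler_wpM2r//.
  by rewrite exprn_ge0// ltW.
have qk : 0 < (#|F|%:R : R) ^+ k by rewrite exprn_gt0// card_field_gt0.
rewrite ler_pdivrMr// mulrC ler_pdivlMr ?ltr0n// mulrC.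
by rewrite -natrM -natrX ler_nat num_irred_le.
Qed.

(** Monotonicity of [(x^k - 1) / k] in [k], cleared of denominators. [P] is the case of consecutive
    exponents. *)
Lemma exprB1_slope x k l : 1 <= x -> (k <= l)%N ->
  l%:R * (x ^+ k - 1) <= k%:R * (x ^+ l - 1).
Proof.
move=> x1; have P j : 0 <= j%:R * x ^+ j.+1 - j.+1%:R * x ^+ j + 1.
  elim: j => [|j IH]; first by rewrite mul0r expr0 mul1r; lra.
  have H : 1 <= x ^+ j.+1 by rewrite exprn_ege1.
  have : 0 <= x * (j%:R * x ^+ j.+1 - j.+1%:R * x ^+ j + 1) by rewrite mulr_ge0//; lra.
  rewrite (exprS x j.+1) -!natr1; move: H; rewrite (exprS x j).
  by move: (j%:R : R) (x ^+ j) => a b; nra.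
elim: l => [|l IH].
  by rewrite leqn0 => /eqP ->; rewrite mul0r.
rewrite leq_eqVlt => /predU1P[->//|kl].
case: l IH kl => [|l] IH kl; first by move: kl; case: k {IH}; rewrite // expr0 subrr !mulr0 mul0r.
have := IH kl; have := P l.+1.
have xk : 1 <= x ^+ k by rewrite exprn_ege1.
have l1 : 0 < (l.+1%:R : R) by rewrite ltr0n.
rewrite -[l.+2%:R]natr1.
move: (l.+1%:R) l1 (x ^+ k) xk (x ^+ l.+1) (x ^+ l.+2) => L L0 y y1 z t.
have : 0 <= k%:R :> R by [].
move: (k%:R : R) => K K0 h1 h2.
rewrite -(ler_pM2l L0).
have : 0 <= (L + 1) * (K * (z - 1) - L * (y - 1)).
  by rewrite mulr_ge0 ?subr_ge0//; lra.
have : 0 <= K * (L * t - (L + 1) * z + 1) by rewrite mulr_ge0.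
by lra.
Qed.

Lemma Hsum_le m : (0 < m)%N -> Hsum R m <= 1 + ln m%:R.
Proof.
elim: m => // -[|m] IH _; first by rewrite /Hsum big_nat1 ln1 invr1 addr0.
have /andP[H _] := @ln_succ_bounds R m.+1 isT.
rewrite HsumS; move: (IH isT) H; move: (m.+2%:R^-1) => y; lra.
Qed.

(** After [H_m] is split off, the sum is cut at [h = m / 2]. As [(x^k - 1) / k] increases, the lower
    part is at most [x^h <= sqrt u], and the upper one has at most [2 m / 3] terms, each at most
    [(u - 1) / m]. A coefficient of [u] below [1] leaves room for powers of [m]. *)
Lemma sum_expr_div_le x u m : (1 < m)%N -> 1 <= x -> x ^+ m = u ->
  \sum_(1 <= k < m.+1) x ^+ k / k%:R <= Hsum R m + (Num.sqrt u + 2 / 3 * u).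
Proof.
move=> m1 x1 xm; have u1 : 1 <= u by rewrite -xm exprn_ege1.
have -> : \sum_(1 <= k < m.+1) x ^+ k / k%:R =
    Hsum R m + \sum_(1 <= k < m.+1) (x ^+ k - 1) / k%:R.
  rewrite /Hsum -big_split/=; apply: eq_bigr => k _.
  by rewrite mulrBl mul1r addrC subrK.
rewrite lerD2l; set h := m./2.
have h0 : (0 < h)%N by rewrite /h; lia.
have hm : (h <= m)%N by rewrite /h; lia.
have le_c k l : (0 < k)%N -> (k <= l)%N -> (x ^+ k - 1) / k%:R <= (x ^+ l - 1) / l%:R.
  move=> k0 kl; rewrite ler_pdivrMr ?ltr0n// mulrAC ler_pdivlMr ?ltr0n; last lia.
  by rewrite mulrC [leRHS]mulrC exprB1_slope.
rewrite (@big_cat_nat _ _ _ h.+1)//=; apply: lerD.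
  apply: (@le_trans _ _ (\sum_(1 <= k < h.+1) (x ^+ h - 1) / h%:R)).
    by apply: ler_sum_nat => k /andP[k0 kh]; exact: le_c.
  rewrite sumr_const_nat subn1/= -[_ / _ *+ _]mulr_natr divfK ?pnatr_eq0 -?lt0n//.
  apply: (@le_trans _ _ (x ^+ h)); first by rewrite gerBl.
  have xh : 0 <= x ^+ h by rewrite exprn_ge0//; lra.
  rewrite -[leLHS]ger0_norm// -sqrtr_sqr ler_wsqrtr// -exprM -xm ler_weXn2l//.
  by rewrite /h; lia.
apply: (@le_trans _ _ (\sum_(h.+1 <= k < m.+1) (x ^+ m - 1) / m%:R)).
  by apply: ler_sum_nat => k /andP[k0 kh]; apply: le_c => //; lia.
rewrite sumr_const_nat subSS -[_ / _ *+ _]mulr_natr xm -mulrA mulrC.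
apply: (@le_trans _ _ (2 / 3 * (u - 1))); last by lra.
rewrite ler_wpM2r ?subr_ge0// mulrC ler_pdivrMr ?ltr0n; last lia.
rewrite natrB//; have : (m%:R : R) <= 3 * h%:R by rewrite -natrM ler_nat /h; lia.
by lra.
Qed.

Lemma rough_prop_lambda_le (A : R) : 1 <= A -> exists2 C : R, 0 < C &
  forall (F : finFieldType) (n m : nat), (0 < m)%N -> (m < n)%N ->
  m%:R <= A * (n%:R / m%:R) ^+ 4 ->
  `|rough_prop F R n m - lambda F R m| <= C / m%:R ^+ 2 * invself_e (n%:R / m%:R).
Proof.
(* [expR 4] collects the constants of the exponent; the rest comes from [m^3 <= A^3 u^12] and
   [u / 48 <= expR (u / 48)]. *)
move=> A1; pose C : R := expR 4 * A ^+ 3 * 48 ^+ 12.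
have C1 : 1 <= C.
  rewrite /C -(mulr1 1) ler_pM// ?exprn_ege1//; last by lra.
  by rewrite -(mulr1 1) ler_pM// ?exprn_ege1// (le_trans _ (expR_ge1Dx _))//; lra.
exists C; first by lra.
move=> F n m m0 mn; set u := n%:R / m%:R => mA.
have m0' : 0 < (m%:R : R) by rewrite ltr0n.
have u1 : 1 < u by rewrite ltr_pdivlMr// mul1r ltr_nat.
have u0 : 0 < u by lra.
(* [x = u^(1/m)], so that [x^m = u] and [x^-n = u^-u]. *)
pose x := expR (ln u / m%:R).
have x1 : 1 <= x.
  by rewrite -[leLHS]expR0 ler_expR divr_ge0// ln_ge0// ltW.
have xm : x ^+ m = u.
  by rewrite -expRM_natl mulrCA divff ?gt_eqF// mulr1 lnK.
have xn : x ^- n = invself u.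
  rewrite -expRM_natl -expRN; congr (expR (- _)).
  by rewrite mulrA mulrAC.
(* For [m = 1] the sum is [u], and Rankin's bound is exactly [(u/e)^-u]. *)
have [m1|m1] := leqP m 1.
  have {m1}m1 : m = 1%N by apply/eqP; rewrite eqn_leq m1.
  apply: le_trans (rough_prop_lambda_rankin F n m x1) _.
  rewrite xn invself_eE m1 big_nat1 divr1 expr1n divr1 -[x ^+ 1]/(x ^+ 1).
  move: xm; rewrite m1 => ->.
  rewrite mulrC ler_peMl// mulr_ge0// ltW ?expR_gt0// invself_gt0.
apply: le_trans (rough_prop_lambda_rankin F n m x1) _.
rewrite xn invself_eE mulrA [leLHS]mulrC ler_wpM2r ?(ltW (invself_gt0 _))//.
(* [sqrt u <= u / 12 + 3] leaves the exponent [3 u / 4]; the spare [expR (- u / 4)] has to absorb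
   [m^3]. *)
apply: (@le_trans _ _ (expR (1 + ln m%:R + (u / 12 + 3 + 2 / 3 * u)))).
  rewrite ler_expR (le_trans (sum_expr_div_le m1 x1 xm))// lerD ?Hsum_le//.
  rewrite lerD2r; have := sqr_sqrtr (ltW u0).
  have := sqrtr_ge0 u; move: (Num.sqrt u) => r r0 <-.
  by have := sqr_ge0 (r - 6); nra.
have -> : 1 + ln m%:R + (u / 12 + 3 + 2 / 3 * u) = 4 + ln m%:R - u / 4 + u by lra.
rewrite expRD ler_wpM2r ?expR_ge0// expRD expRD lnK ?posrE// expRN.
rewrite ler_pdivrMr ?expR_gt0// mulrAC ler_pdivlMr ?exprn_gt0//.
have -> : C * expR (u / 4) = expR 4 * (A ^+ 3 * (48 ^+ 12 * expR (u / 4))).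
  by rewrite /C; ring.
rewrite -mulrA -exprS ler_pM2l ?expR_gt0//.
apply: (@le_trans _ _ ((A * u ^+ 4) ^+ 3)).
  by rewrite lerXn2r ?nnegrE// mulr_ge0 ?exprn_ge0//; lra.
rewrite exprMn -exprM ler_pM2l ?exprn_gt0//; last by lra.
have -> : u / 4 = 12%:R * (u / 48) by lra.
rewrite expRM_natl -exprMn; apply: lerXn2r; rewrite ?nnegrE ?(ltW u0)//.
by have := expR_ge1Dx (u / 48); lra.
Qed.

End Rankin.

(** * Small u *)

Section EntropyBounds.
Variable R : realType.
Implicit Types u v : R.

Lemma invself_e_shift v u : 0 < v -> v <= u ->
  invself_e v <= invself_e u * expR ((u - v) * ln u).
Proof.
move=> v0 vu; rewrite -expRD ler_expR.
by have /andP[_] := mul_ln_bounds v0 vu; lra.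
Qed.

Lemma invself_e_decrement v u : 0 < v -> v <= u ->
  (u - v) * ln v * invself_e u <= invself_e v - invself_e u.
Proof.
move=> v0 vu.
suff : (1 + (u - v) * ln v) * invself_e u <= invself_e v by lra.
have -> : invself_e v = expR ((v - v * ln v) - (u - u * ln u)) * invself_e u.
  by rewrite -expRD subrK.
rewrite ler_pM2r ?invself_e_gt0//; apply: le_trans (expR_ge1Dx _).
by rewrite lerD2l; have /andP[] := mul_ln_bounds v0 vu; lra.
Qed.

Lemma invself_e_ge u : 1 <= u -> expR (- u ^+ 2) <= invself_e u.
Proof.
move=> u1; rewrite ler_expR.
have H : -1 < u - 1 by lra.
have := le_ln1Dx H; rewrite addrC subrK => lnu.
have : u * ln u <= u * (u - 1) by rewrite ler_wpM2l//; lra.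
by lra.
Qed.

End EntropyBounds.

(** * Comparison of the proportions with Buchstab's function *)

Section ModelError.
Variables (F : finFieldType) (R : realType).
Local Notation s := (Num.sqrt (#|F|%:R : R)).
Local Notation a n m := (rough_prop F R n m).
Local Notation w := (@buchstab R).
Local Notation sigma m := (8 * s ^- m.+1).

(** The model [w(n/m)/m] is [1/n] for [m <= n <= 2m]; its distance to [lambda e^gamma w(n/m)] is
    controlled later by [lambda_gap]. *)
Definition model_error (m n : nat) : R := a n m - w (n%:R / m%:R) / m%:R.
Local Notation h := model_error.

(** The delayed term [a (n - m)] is [1] at [n = m] and vanishes for [m < n <= 2m], so [n a n] stays
    near [1] and each step adds one tail error. The indices reached are [m + 1] to [2m + 1]. *)
Lemma rough_prop_first_window m j : (0 < m)%N -> (j <= m)%N ->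
  `|(m + j).+1%:R * a (m + j).+1 m - 1| <= j.+1%:R * sigma m.
Proof.
move=> m0; elim: j => [|j IH] jm.
  have := rough_prop_recursion F R (leqnn m).
  rewrite addn0 subnn rough_prop0 (rough_prop_eq0 F R (n := m)) ?m0 ?leqnn// !subr0 => ->.
  by rewrite addrC addKr normrN mul1r tail_error_le.
have mn : (m <= (m + j).+1)%N by lia.
have := rough_prop_recursion F R mn.
rewrite (_ : (m + j).+1 - m = j.+1)%N; last lia.
rewrite (rough_prop_eq0 F R (n := j.+1)) ?jm// sub0r addnS.
set n := (m + j).+1; rewrite -natr1 => e.
have -> : (n%:R + 1) * a n.+1 m - 1 = (n%:R * a n m - 1) - tail_error F R n.+1 m.
  by rewrite -[LHS](subrK ((n%:R + 1) * a n m)); lra.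
rewrite (le_trans (ler_normB _ _))// -natr1 mulrDl mul1r lerD//; first exact: IH (ltnW jm).
exact: tail_error_le.
Qed.

Lemma model_increment m n : (0 < m)%N -> (2 * m <= n)%N ->
  exists2 c : R, n%:R / m%:R < c < n.+1%:R / m%:R &
    n.+1%:R * (w (n.+1%:R / m%:R) / m%:R) - n%:R * (w (n%:R / m%:R) / m%:R) =
    w (c - 1) / m%:R.
Proof.
move=> m0 mn; have M0 : 0 < (m%:R : R) by rewrite ltr0n.
have v2 : 2 <= (n%:R / m%:R : R) by rewrite ler_pdivlMr// -natrM ler_nat.
have vu : (n%:R / m%:R : R) < n.+1%:R / m%:R by rewrite ltr_pM2r ?invr_gt0// ltr_nat.
have [c cvu e] := buchstab_increment v2 vu; exists c => //.
rewrite !mulrA ![_%:R * w _]mulrC.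
rewrite -![w _ * _ * _]mulrA ![w (_ / _) * _]mulrC e.
by rewrite -mulrBl -natr1 addrAC subrr add0r mul1r.
Qed.

Lemma model_error_recursion m n : (0 < m)%N -> (2 * m <= n)%N ->
  exists2 c : R, n%:R / m%:R < c < n.+1%:R / m%:R &
    n.+1%:R * (h m n.+1 - h m n) = h m (n - m) - h m n - tail_error F R n.+1 m -
      (w (c - 1) - w (n%:R / m%:R - 1)) / m%:R.
Proof.
move=> m0 mn; have M0 : 0 < (m%:R : R) by rewrite ltr0n.
have [c cvu e] := model_increment m0 mn; exists c => //.
have mn' : (m <= n)%N by lia.
have := rough_prop_recursion F R mn'.
have e2 : (n - m)%:R / m%:R = n%:R / m%:R - 1 :> R.
  by rewrite natrB// mulrBl divff// gt_eqF.
rewrite /h e2; move: e; rewrite -natr1.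
move: (w _ / m%:R) (w _ / m%:R) => x y; rewrite mulrBl.
move: (w _ / m%:R) (w _ / m%:R) => z t.
move: (n%:R : R) => N; lra.
Qed.

Lemma divr_natS m n : (0 < m)%N -> n.+1%:R / m%:R - n%:R / m%:R = m%:R^-1 :> R.
Proof. by move=> m0; rewrite -mulrBl -natr1 addrAC subrr add0r mul1r. Qed.

Lemma model_error_recursion_le m n : (0 < m)%N -> (2 * m <= n)%N ->
  `|n.+1%:R * (h m n.+1 - h m n) - (h m (n - m) - h m n)| <= sigma m + m%:R ^- 2.
Proof.
move=> m0 mn; have M0 : 0 < (m%:R : R) by rewrite ltr0n.
have [c /andP[c1 c2] ->] := model_error_recursion m0 mn.
have v2 : 2 <= (n%:R / m%:R : R) by rewrite ler_pdivlMr// -natrM ler_nat.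
set T := tail_error F R n.+1 m; set E := (_ - _) / m%:R.
have -> : h m (n - m) - h m n - T - E - (h m (n - m) - h m n) = - (T + E) by lra.
rewrite normrN (le_trans (ler_normD _ _))// lerD ?tail_error_le//.
rewrite /E normrM [`|m%:R^-1|]gtr0_norm ?invr_gt0// expr2 invfM ler_pM2r ?invr_gt0//.
have v1 : 1 <= (n%:R / m%:R : R) - 1 by lra.
have vc : (n%:R / m%:R : R) - 1 <= c - 1 by lra.
apply: (le_trans (buchstab_lipschitz v1 vc)).
by rewrite -(divr_natS n m0); lra.
Qed.

(** From [3 m] on, the delayed arguments are at least [2], and a decaying bound can replace the
    Lipschitz bound. *)
Lemma model_error_recursion_local (C : R) m n : 0 <= C ->
  (forall v u, 2 <= v -> v <= u -> `|w u - w v| <= C * (u - v) * invself_e v) ->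
  (0 < m)%N -> (3 * m <= n)%N ->
  `|n.+1%:R * (h m n.+1 - h m n) - (h m (n - m) - h m n)| <=
    sigma m + C / m%:R ^+ 2 * invself_e (n%:R / m%:R - 1).
Proof.
move=> C0 HC m0 mn; have M0 : 0 < (m%:R : R) by rewrite ltr0n.
have mn2 : (2 * m <= n)%N by lia.
have [c /andP[c1 c2] ->] := model_error_recursion m0 mn2.
have v3 : 3 <= (n%:R / m%:R : R) by rewrite ler_pdivlMr// -natrM ler_nat.
set T := tail_error F R n.+1 m; set E := (_ - _) / m%:R.
have -> : h m (n - m) - h m n - T - E - (h m (n - m) - h m n) = - (T + E) by lra.
rewrite normrN (le_trans (ler_normD _ _))// lerD ?tail_error_le//.
rewrite /E normrM [`|m%:R^-1|]gtr0_norm ?invr_gt0// ler_pdivrMr//.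
have v1 : 2 <= (n%:R / m%:R : R) - 1 by lra.
have vc : (n%:R / m%:R : R) - 1 <= c - 1 by lra.
apply: (le_trans (HC _ _ v1 vc)).
rewrite [leRHS]mulrAC ler_wpM2r ?(ltW (invself_e_gt0 _))//.
rewrite expr2 invfM mulrA divfK ?gt_eqF// ler_wpM2l//.
by rewrite -(divr_natS n m0); lra.
Qed.

(** Multiples of [n] are supersolutions: with [B = (C + 1) / m^3], one has
    [n (B n) + B (n - m) + B m <= B (n + 1)^2]. *)
Lemma model_error_linear (C : R) m n : (0 < m)%N -> sigma m <= C / m%:R ^+ 2 ->
  (m < n)%N -> `|h m n| <= (C + 1) / m%:R ^+ 3 * n%:R.
Proof.
move=> m0 Hs; have M0 : 0 < (m%:R : R) by rewrite ltr0n.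
have M1 : 1 <= (m%:R : R) by rewrite ler1n.
have C0 : 0 <= C.
  have : 0 <= sigma m by rewrite mulr_ge0// invr_ge0 exprn_ge0// sqrtr_ge0.
  by move=> /le_trans/(_ Hs); rewrite pmulr_lge0// invr_gt0 exprn_gt0.
have B0 : 0 <= (C + 1) / m%:R ^+ 3 by rewrite divr_ge0 ?exprn_ge0 ?ltW//; lra.
have first_window j : (j <= m)%N ->
    `|(m + j).+1%:R * (a (m + j).+1 m) - 1| <= (m + j).+1%:R * (C / m%:R ^+ 2).
  move=> jm; apply: le_trans (rough_prop_first_window m0 jm) _.
  apply: ler_pM => //.
  by rewrite ler_nat ltnS leq_addl.
elim/ltn_ind: n => n IH mn.
have n0 : 0 < (n%:R : R) by rewrite ltr0n; lia.
have Mn : m%:R <= (n%:R : R) by rewrite ler_nat ltnW.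
have V3 : (C + 1) / m%:R ^+ 3 * n%:R = (C + 1) / m%:R ^+ 2 * (n%:R / m%:R).
  by rewrite exprSr invfM; ring.
have nM1 : 1 <= (n%:R / m%:R : R) by rewrite ler_pdivlMr// mul1r.
have le_first : (C + 1) / m%:R ^+ 2 <= (C + 1) / m%:R ^+ 3 * n%:R.
  by rewrite V3 ler_peMr// divr_ge0 ?exprn_ge0 ?(ltW M0)//; lra.
have [nm|nm] := leqP n (2 * m).
  have nE : n = (m + (n - m.+1)).+1 by lia.
  have jm : (n - m.+1 <= m)%N by lia.
  have := first_window _ jm; rewrite -nE => H.
  have e : n%:R * h m n = n%:R * a n m - 1.
    rewrite /h buchstab_inv; last first.
      by rewrite nM1 ler_pdivrMr// -natrM ler_nat.
    by rewrite mulrBr invf_div [m%:R / _]mulrC mulfK ?gt_eqF// divff// gt_eqF.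
  apply: le_trans le_first; rewrite -(ler_pM2l n0) -{1}(gtr0_norm n0) -normrM e.
  apply: le_trans H _; rewrite ler_pM2l// ler_pM2r ?invr_gt0 ?exprn_gt0//; lra.
(* [n = 2m + 1] is separate: the recursion would refer to index [m], where the error is [- 1 / m],
   but the first-window bound still applies. *)
have [nm'|nm'] := leqP n (2 * m).+1.
  have {nm nm'}nE : n = (2 * m).+1 by lia.
  have := first_window _ (leqnn m); rewrite addnn -mul2n -nE => H.
  have [c /andP[c1 c2] e] := model_increment m0 (leqnn (2 * m)).
  have e2m : (2 * m)%:R / m%:R = 2 :> R by rewrite natrM mulfK// gt_eqF.
  rewrite e2m in e c1.
  have := @buchstab_inv R 2; rewrite lexx ler1n => /(_ isT) w2.
  have e1 : (2 * m)%:R * (w 2 / m%:R) = 1.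
    by rewrite w2 natrM; field; rewrite gt_eqF.
  rewrite e1 -nE in e.
  have /andP[b1 b2] : 2^-1 <= w (c - 1) <= 1 by apply: buchstab_bounds; lra.
  apply: le_trans le_first; rewrite -(ler_pM2l n0) -{1}(gtr0_norm n0) -normrM.
  have -> : n%:R * h m n = (n%:R * a n m - 1) - w (c - 1) / m%:R.
    by rewrite /h -e mulrBr; lra.
  rewrite (le_trans (ler_normB _ _))// [(C + 1) / _]mulrDl mulrDr lerD//.
  rewrite ger0_norm; last by rewrite divr_ge0//; lra.
  have -> : n%:R * (1 / m%:R ^+ 2) = n%:R / m%:R / m%:R :> R by field; rewrite gt_eqF.
  by rewrite ler_pM2r ?invr_gt0//; lra.
case: n IH mn n0 Mn V3 nM1 le_first nm nm' => // n IH mn n0 Mn _ _ _ nm nm'.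
have mn2 : (2 * m <= n)%N by lia.
have := model_error_recursion_le m0 mn2.
have := IH n (ltnSn _) ltac:(lia); have := IH (n - m)%N ltac:(lia) ltac:(lia).
rewrite natrB; last lia.
set B := (C + 1) / m%:R ^+ 3 in B0 *.
have HB : sigma m + m%:R ^- 2 <= B * m%:R.
  have -> : B * m%:R = C / m%:R ^+ 2 + m%:R ^- 2 by rewrite /B; field; rewrite gt_eqF.
  exact: lerD.
move: HB; move: (sigma m + _) => D HB H1 H2 H3.
rewrite -(ler_pM2l n0) -{1}(gtr0_norm n0) -normrM.
have -> : n.+1%:R * h m n.+1 = (n.+1%:R * (h m n.+1 - h m n) - (h m (n - m) - h m n)) +
    (n%:R * h m n + h m (n - m)) by rewrite -natr1; lra.
apply: (@le_trans _ _ (D + (n%:R * (B * n%:R) + B * (n%:R - m%:R)))).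
  rewrite (le_trans (ler_normD _ _))// lerD//.
  rewrite (le_trans (ler_normD _ _))// lerD// normrM ger0_norm// ler_wpM2l//.
have : 0 <= B * n.+1%:R by rewrite mulr_ge0.
by rewrite -natr1; move: HB {B0 H1 H2 H3}; move: B (n%:R : R) (m%:R : R) => B' N M; lra.
Qed.

End ModelError.

(** * Decay of the comparison error *)

Section Decay.
Variable R : realType.
Local Notation w := (@buchstab R).

(** From [1 / s <= 3/4 <= expR (- 1/4)] the left side decays like [expR (- m / 4)]. Half of the
    exponent absorbs [m^2], the other half [expR (k^2)], as [8 k^2 <= k^4 + 16 <= m + 16]. *)
Lemma tail_bound_small : exists2 C : R, 0 < C &
  forall (F : finFieldType) (m k : nat), (0 < m)%N -> (k ^ 4 <= m)%N ->
    8 * Num.sqrt (#|F|%:R : R) ^- m.+1 <= C / m%:R ^+ 2 * expR (- k%:R ^+ 2).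
Proof.
exists (8 * 16 ^+ 2 * expR 2); first by rewrite !mulr_gt0 ?exprn_gt0// expR_gt0.
move=> F m k m0 km; have M0 : 0 < (m%:R : R) by rewrite ltr0n.
have sm : Num.sqrt (#|F|%:R : R) ^- m.+1 <= expR (- (m%:R / 4)).
  have s0 := sqrt_card_gt0 F R; have s1 := sqrt_card_gt F R.
  apply: (@le_trans _ _ (expR (- 4^-1) ^+ m.+1)).
    rewrite -exprVn lerXn2r ?nnegrE ?invr_ge0 ?(ltW s0) ?expR_ge0//.
    apply: le_trans (expR_ge1Dx _).
    by rewrite -[leLHS]div1r ler_pdivrMr//; lra.
  rewrite -expRM_natl ler_expR -[m.+1%:R]natr1; lra.
apply: (@le_trans _ _ (8 * expR (- (m%:R / 4)))); first by rewrite ler_pM2l.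
rewrite !expRN ler_pdivrMr ?expR_gt0// mulrAC ler_pdivlMr ?expR_gt0//.
rewrite mulrAC ler_pdivlMr ?exprn_gt0//.
have h1 : expR (k%:R ^+ 2) <= expR (m%:R / 8 + 2) :> R.
  rewrite ler_expR; have : (k%:R : R) ^+ 4 <= m%:R by rewrite -natrX ler_nat.
  by rewrite (exprM _ 2 2); have := sqr_ge0 (k%:R ^+ 2 - 4 : R); lra.
have h2 : (m%:R / 16) ^+ 2 <= expR (m%:R / 8) :> R.
  have -> : (m%:R / 8 : R) = 2%:R * (m%:R / 16) by lra.
  rewrite expRM_natl; apply: lerXn2r; rewrite ?nnegrE ?expR_ge0 ?divr_ge0//.
  by have := expR_ge1Dx (m%:R / 16 : R); lra.
have -> : (m%:R / 4 : R) = m%:R / 8 + m%:R / 8 by lra.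
apply: (@le_trans _ _ (8 * expR (m%:R / 8 + 2) * m%:R ^+ 2)).
  by rewrite ler_pM2r ?exprn_gt0// ler_pM2l.
rewrite [expR (_ + 2)]expRD [expR (_ + m%:R / 8)]expRD; move: h2; have := expR_gt0 (m%:R / 8 : R); have := expR_gt0 (2 : R).
move: (expR 2) (expR (m%:R / 8)) => x y x0 y0 h2.
have := mulr_ge0 (mulr_ge0 (ltW x0) (ltW y0)) (ltW M0).
have : x * y * (m%:R / 16) ^+ 2 <= x * y * y by rewrite ler_pM2l// mulr_gt0.
by lra.
Qed.

Lemma model_error_small_increment (F : finFieldType) (C : R) m n : (0 < m)%N ->
  8 * Num.sqrt (#|F|%:R : R) ^- m.+1 <= C / m%:R ^+ 2 -> (2 * m < n)%N ->
  `|model_error F R m n.+1 - model_error F R m n| <= 3 * ((C + 1) / m%:R ^+ 3).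
Proof.
move=> m0 Hs mn; have M0 : 0 < (m%:R : R) by rewrite ltr0n.
have := model_error_recursion_le F R m0 (ltnW mn).
have := model_error_linear m0 Hs (n := n) ltac:(lia).
have := model_error_linear m0 Hs (n := n - m) ltac:(lia).
have : 8 * Num.sqrt (#|F|%:R : R) ^- m.+1 + m%:R ^- 2 <= (C + 1) / m%:R ^+ 3 * m%:R.
  have -> : (C + 1) / m%:R ^+ 3 * m%:R = C / m%:R ^+ 2 + m%:R ^- 2.
    by field; rewrite gt_eqF.
  exact: lerD.
have B0 : 0 <= (C + 1) / m%:R ^+ 3.
  have : 0 <= 8 * Num.sqrt (#|F|%:R : R) ^- m.+1.
    by rewrite mulr_ge0// invr_ge0 exprn_ge0// sqrtr_ge0.
  move=> /le_trans/(_ Hs); rewrite pmulr_lge0 ?invr_gt0 ?exprn_gt0// => C0.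
  by rewrite divr_ge0 ?exprn_ge0 ?(ltW M0)//; lra.
move: (model_error F R m n.+1) (model_error F R m n) (model_error F R m (n - m)).
move: (8 * _ + _) => D x y z; rewrite natrB; last lia.
have Mn : m%:R <= (n%:R : R) by rewrite ler_nat; lia.
have n0 : 0 < (n.+1%:R : R) by rewrite ltr0n.
move: ((C + 1) / _) B0 => B B0 h1 h2 h3 h4.
rewrite -(ler_pM2l n0) -{1}(gtr0_norm n0) -normrM.
have -> : n.+1%:R * (x - y) = (n.+1%:R * (x - y) - (z - y)) + (z - y) by lra.
apply: le_trans (ler_normD _ _) _.
apply: (@le_trans _ _ (B * m%:R + (B * (n%:R - m%:R) + B * n%:R))).
  apply: lerD; first exact: le_trans h4 h1.
  by apply: le_trans (ler_normB _ _) _; exact: lerD.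
have := mulr_ge0 B0 (ltW M0); have : 0 <= B * n%:R by rewrite mulr_ge0.
by rewrite -natr1; move: h1 h2 h3 h4 => _ _ _ _; move: (n%:R : R) => N; lra.
Qed.

(** The increments of the error are majorized by [C / m^2] times the decrements of [invself_e].
    Going back over a window of length [m] costs a factor [2 v], against the [3 v] gained from
    [ln >= 3]; the surplus [C v] absorbs the errors [Cs] and [2 Cl]. The range [n <= k m] keeps the
    tail error comparable, since [expR (- k^2) <= invself_e v] for [v <= k]. *)
Lemma model_error_decay : exists2 C : R, 0 < C &
  forall (F : finFieldType) (m k : nat), (66 <= k)%N -> (k ^ 4 <= m)%N ->
    (forall n, (m < n)%N -> `|model_error F R m n| <= C / m%:R ^+ 3 * n%:R) /\
    (forall n, (65 * m <= n <= k * m)%N ->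
       `|model_error F R m n - model_error F R m (k * m)| <=
         C / m%:R ^+ 2 * invself_e (n%:R / m%:R)).
Proof.
have [Cs Cs0 Hs] := tail_bound_small.
have [Cl Cl0 Hl] := buchstab_local R.
have i66 := @invself_e_gt0 R 66.
(* The summands serve in turn for the linear bound, the initial window up to [66 m], and the
   inductive step. *)
pose C := (Cs + 1) + (Cs + 1) / invself_e 66 + 2 * Cl + Cs.
have D0 : 0 < (Cs + 1) / invself_e 66 by rewrite divr_gt0//; lra.
exists C; first by rewrite /C; lra.
move=> F m k k66 km; have k1 : (1 < k)%N by exact: leq_trans k66.
have k2m : (2 * k <= m)%N.
  apply: leq_trans km; rewrite (expnSr k 3) leq_mul2r (leq_trans k1) ?orbT//.
  by rewrite -[leqLHS]expn1 leq_exp2l.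
have m0 : (0 < m)%N by apply: leq_trans k2m; rewrite muln_gt0 /= ltnW.
have M0 : 0 < (m%:R : R) by rewrite ltr0n.
have V0 : 0 < (m%:R ^- 2 : R) by rewrite invr_gt0 exprn_gt0.
have Hs1 := Hs F m k m0 km.
have Hs2 : 8 * Num.sqrt (#|F|%:R : R) ^- m.+1 <= Cs / m%:R ^+ 2.
  apply: le_trans Hs1 _; apply: ler_piMr; first by rewrite mulr_ge0 ?(ltW V0) ?(ltW Cs0).
  by rewrite expR_le1 oppr_le0 sqr_ge0.
pose h := model_error F R m; rewrite -/h.
have CB : Cs + 1 <= C by rewrite /C; lra.
split=> [n mn|].
  apply: le_trans (model_error_linear m0 Hs2 mn) _.
  by rewrite ler_wpM2r// ler_pM2r// invr_gt0 exprn_gt0.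
pose U (n : nat) : R := n%:R / m%:R.
have US n : U n.+1 - U n = m%:R^-1 by exact: divr_natS.
have Ule i j : (i <= j)%N -> U i <= U j.
  by move=> ij; rewrite ler_pM2r ?invr_gt0// ler_nat.
have Uge c n : (c * m <= n)%N -> c%:R <= U n.
  by move=> cn; rewrite ler_pdivlMr// -natrM ler_nat.
have Ule' c n : (n <= c * m)%N -> U n <= c%:R.
  by move=> cn; rewrite ler_pdivrMr// -natrM ler_nat.
have drop n : (65 * m <= n)%N ->
    3 / m%:R * invself_e (U n.+1) <= invself_e (U n) - invself_e (U n.+1).
  move=> n65; have u65 := Uge _ _ n65; have := Ule _ _ (leqnSn n) => uu.
  have u0 : 0 < U n by lra.
  apply: le_trans (invself_e_decrement u0 uu); rewrite US.
  rewrite ler_pM2r ?invself_e_gt0// mulrC ler_pM2l ?invr_gt0//.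
  by apply: ln_ge3; lra.
have telescope i j : (i <= j)%N ->
    (forall n, (i <= n < j)%N ->
      `|h n.+1 - h n| <= C / m%:R ^+ 2 * (invself_e (U n) - invself_e (U n.+1))) ->
    `|h j - h i| <= C / m%:R ^+ 2 * (invself_e (U i) - invself_e (U j)).
  move=> ij H; rewrite -(telescope_sumr _ ij) (le_trans (ler_norm_sum _ _ _))//.
  rewrite -[_ (U i) - _]opprB -(telescope_sumr (fun n => invself_e (U n)) ij).
  rewrite -sumrN mulr_sumr; apply: ler_sum_nat => n nij.
  by rewrite opprB; exact: H.
have step n : (65 * m <= n)%N -> (n < k * m)%N ->
    `|h n.+1 - h n| <= C / m%:R ^+ 2 * (invself_e (U n) - invself_e (U n.+1)).
  elim/ltn_ind: n => n IH n65 nk.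
  have n2 : (2 * m < n)%N by apply: leq_trans n65; rewrite ltn_pmul2r.
  have mn : (m <= n)%N by apply: leq_trans n65; rewrite leq_pmull.
  apply: le_trans; last first.
    by apply: ler_wpM2l (drop n n65); rewrite mulr_ge0 ?(ltW V0)//; lra.
  (* Below [66 m] the window [[n - m, n]] leaves the range of the induction, so the crude increment
     bound is used. *)
  have [n66|n66] := ltnP n (66 * m).
    apply: le_trans (model_error_small_increment m0 Hs2 n2) _.
    have v66 := Ule' _ _ n66.
    have v1 : 1 <= U n.+1 by apply: (Uge 1%N); rewrite mul1n leqW.
    have -> : C / m%:R ^+ 2 * (3 / m%:R * invself_e (U n.+1)) =
        3 * ((C * invself_e (U n.+1)) / m%:R ^+ 3) by field; rewrite gt_eqF.
    rewrite ler_pM2l// ler_pM2r ?invr_gt0 ?exprn_gt0//.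
    apply: (@le_trans _ _ (C * invself_e 66)).
      by rewrite -ler_pdivrMr// /C; lra.
    by rewrite ler_pM2l ?invself_e_nincr//; lra.
  have h65 : (65 * m <= n - m)%N by rewrite leq_subRL// -mulSn.
  have win : `|h n - h (n - m)%N| <= C / m%:R ^+ 2 * invself_e (U (n - m)%N).
    have nm : (n - m <= n)%N by exact: leq_subr.
    apply: (le_trans (telescope _ _ nm _)).
      by move=> j /andP[j1 j2]; apply: IH => //; [exact: leq_trans j1|exact: ltn_trans nk].
    by rewrite ler_wpM2l ?mulr_ge0 ?(ltW V0)// ?gerBl ?(ltW (invself_e_gt0 _))//; lra.
  have n3 : (3 * m <= n)%N by apply: leq_trans n65; rewrite leq_mul2r orbT.
  have := model_error_recursion_local F (ltW Cl0) Hl m0 n3.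
  rewrite -/h -/(U n).
  have -> : U n - 1 = U (n - m)%N.
    by rewrite /U natrB// mulrBl divff ?gt_eqF.
  set v := U n.+1.
  have v66 : 66 <= v by apply: (Uge 66%N); exact: leqW.
  have vk : v <= k%:R by exact: (Ule' k).
  have vU : v - U (n - m)%N = 1 + m%:R^-1.
    rewrite -(US n) -/v (_ : U (n - m)%N = U n - 1); first by lra.
    by rewrite /U natrB// mulrBl divff ?gt_eqF.
  (* The shift is [1 + 1/m], and [v^(1/m) <= e^(1/2) <= 2] because [ln v <= v <= k <= m / 2]. *)
  have phi_shift : invself_e (U (n - m)%N) <= 2 * v * invself_e v.
    have u0 : 0 < U (n - m)%N.
      have := Uge 65%N (n - m)%N h65; lra.
    have uv : U (n - m)%N <= v by apply: Ule; apply: leqW; exact: leq_subr.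
    apply: le_trans (invself_e_shift u0 uv) _.
    rewrite mulrC ler_pM2r ?invself_e_gt0// vU mulrDl mul1r expRD lnK ?posrE; last by lra.
    rewrite mulrC ler_pM2r; last by lra.
    have le12 : m%:R^-1 * ln v <= 2^-1.
      have lnv : ln v <= v.
        have H : -1 < v - 1 by lra.
        by have := le_ln1Dx H; rewrite addrC subrK; lra.
      rewrite mulrC ler_pdivrMr//; apply: le_trans lnv _.
      apply: le_trans vk _.
      rewrite -[leLHS](mulKf (_ : 2 != 0 :> R))// ler_pM2l ?invr_gt0//.
      by rewrite -natrM ler_nat.
    apply: (@le_trans _ _ (expR 2^-1)); first by rewrite ler_expR.
    have e1 : expR 1 = expR 2^-1 ^+ 2 :> R by rewrite -expRM_natl divff.
    have := expR1_le4 R; rewrite e1 expr2; have := expR_ge0 (2^-1 : R); nra.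
  have sig : 8 * Num.sqrt (#|F|%:R : R) ^- m.+1 <= Cs / m%:R ^+ 2 * (v * invself_e v).
    apply: le_trans Hs1 _; rewrite ler_pM2l ?mulr_gt0//.
    apply: (@le_trans _ _ (invself_e v)).
      have v1 : 1 <= v by lra.
      apply: le_trans (invself_e_ge v1); rewrite ler_expR lerN2 lerXn2r ?nnegrE//; lra.
    by rewrite ler_peMl ?(ltW (invself_e_gt0 _))//; lra.
  have vn : v * m%:R = n.+1%:R by rewrite /v /U divfK// gt_eqF.
  move: win phi_shift sig; have := invself_e_gt0 v.
  move: (invself_e v) (invself_e (U (n - m)%N)) => p p' p0.
  move: (h n.+1) (h n) (h (n - m)%N) => x y z.
  have n0 : 0 < (n.+1%:R : R) by rewrite ltr0n.
  move: (8 * _) => sg H1 H2 H3 H4.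
  rewrite -(ler_pM2l n0) -{1}(gtr0_norm n0) -normrM.
  have -> : n.+1%:R * (x - y) = (n.+1%:R * (x - y) - (z - y)) + (z - y) by lra.
  apply: le_trans (ler_normD _ _) _.
  rewrite distrC in H1.
  have -> : n.+1%:R * (C / m%:R ^+ 2 * (3 / m%:R * p)) = m%:R ^- 2 * (3 * C * (v * p)).
    by rewrite -vn; field; rewrite gt_eqF.
  apply: (@le_trans _ _ (m%:R ^- 2 * (Cs * (v * p) + Cl * p' + C * p'))).
    by move: H1 H3 H4; move: (m%:R ^- 2) => V; lra.
  rewrite ler_pM2l//.
  have vp : 0 <= v * p by rewrite mulr_ge0 ?(ltW p0)//; lra.
  have : (Cl + C) * p' <= (Cl + C) * (2 * (v * p)).
    by rewrite ler_pM2l; lra.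
  have : (2 * Cl + Cs) * (v * p) <= C * (v * p).
    by rewrite ler_wpM2r// /C; lra.
  by lra.
move=> n /andP[n65 nk]; rewrite distrC; apply: (le_trans (telescope _ _ nk _)).
  by move=> j /andP[j1 j2]; apply: step => //; exact: leq_trans j1.
rewrite ler_wpM2l ?mulr_ge0 ?(ltW V0)// ?gerBl ?(ltW (invself_e_gt0 _))//; lra.
Qed.

End Decay.

(** * The main term *)

Section Asymptotics.
Variable R : realType.
Local Notation w := (@buchstab R).
Local Notation gam := (euler_gamma R).

(** The [9] is [8] from [lambda_bounds] plus [1] from [euler_gamma_bounds]. *)
Lemma lambda_mertens (F : finFieldType) m : (0 < m)%N ->
  expR (- (gam + 9 / m%:R)) / m%:R <= lambda F R m <= expR (- gam) / m%:R.
Proof.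
move=> m0; have M0 : 0 < (m%:R : R) by rewrite ltr0n.
have /andP[g1 g2] := euler_gamma_bounds R m0.
have /andP[l1 l2] := lambda_bounds F R m0.
have E (x : R) : expR (- x) / m%:R = expR (- (x + ln m%:R)).
  by rewrite opprD expRD [expR (- ln _)]expRN lnK.
rewrite !E; apply/andP; split.
  apply: le_trans l1; rewrite ler_expR lerN2.
  have s1 : 1 <= Num.sqrt (#|F|%:R : R) by apply: le_trans (sqrt_card_gt F R); lra.
  have : 8 / (m%:R * Num.sqrt (#|F|%:R : R) ^+ m.+1) <= 8 / m%:R.
    rewrite ler_pM2l// lef_pV2 ?posrE ?mulr_gt0 ?exprn_gt0// ?(lt_le_trans ltr01 s1)//.
    by rewrite ler_peMr ?(ltW M0)// exprn_ege1.
  have -> : 9 / m%:R = 8 / m%:R + m%:R^-1 :> R by lra.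
  move: (8 / _) (8 / _) => x y; move: g2; move: (m%:R^-1) => z; lra.
by apply: (le_trans l2); rewrite ler_expR lerN2; lra.
Qed.

Lemma euler_gamma_ge0 : 0 <= gam.
Proof.
have /andP[_] := @euler_gamma_bounds R 1 isT.
by rewrite /Hsum big_nat1 ln1 invr1; lra.
Qed.

Lemma lambda_gap (F : finFieldType) m : (0 < m)%N ->
  0 <= m%:R^-1 - lambda F R m * expR gam <= 9 / m%:R ^+ 2.
Proof.
move=> m0; have M0 : 0 < (m%:R : R) by rewrite ltr0n.
have /andP[l1 l2] := lambda_mertens F m0.
have E0 := expR_gt0 gam.
apply/andP; split.
  rewrite subr_ge0; apply: (@le_trans _ _ (expR (- gam) / m%:R * expR gam)).
    by rewrite ler_pM2r.
  by rewrite mulrAC -expRD addrC subrr expR0 mul1r.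
rewrite lerBlDr -lerBlDl; apply: (@le_trans _ _ (expR (- (gam + 9 / m%:R)) / m%:R * expR gam)).
  rewrite mulrAC -expRD (_ : - (gam + 9 / m%:R) + gam = - (9 / m%:R)); last by lra.
  have -> : m%:R^-1 - 9 / m%:R ^+ 2 = (1 + - (9 / m%:R)) / m%:R :> R.
    by field; rewrite gt_eqF.
  by rewrite ler_pM2r ?invr_gt0// expR_ge1Dx.
by rewrite ler_pM2r.
Qed.

Lemma invself_e_le4 (u : R) : 1 <= u -> invself_e u <= 4.
Proof.
move=> u1; apply: (@le_trans _ _ (invself_e 1)); first by apply: invself_e_nincr.
by rewrite /invself_e ln1 mulr0 subr0 expR1_le4.
Qed.

Lemma fourth_root m : exists2 k, (k ^ 4 <= m)%N & (m < k.+1 ^ 4)%N.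
Proof.
elim: m => [|m [k k1 k2]]; first by exists 0%N.
have [H|H] := ltnP m.+1 (k.+1 ^ 4); first by exists k => //; exact: leqW.
exists k.+1 => //; apply: leq_ltn_trans k2 _; rewrite ltn_exp2r//.
Qed.

(** Over ['F_2], with [m = k^4] and [n = k m], both regimes apply: the proportion is close to
    [lambda] and to [w(k)/m], and [lambda] is close to [expR (- gam) / m], all up to [O(m^-2)].
    Hence [w(k)] tends to [expR (- gam)], and [buchstab_cauchy] gives the rate. *)
Lemma buchstab_limit : exists2 C : R, 0 < C &
  forall u, 1 <= u -> `|w u - expR (- gam)| <= C * invself u.
Proof.
have [Cc Cc0 Hc] := buchstab_cauchy R.
have [Cd Cd0 Hd] := model_error_decay R.
have [Ca Ca0 Ha] := rough_prop_lambda_le (lexx (1 : R)).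
exists Cc => // u u1; apply/ler_addgt0Pr => e e0.
(* [70 = 66 + 4]: the linear bound at [66 m], plus the decay bound from there to [k m] with
   [invself_e 66 <= 4]. *)
pose K : R := 70 * Cd + 4 * Ca + 9.
have K0 : 0 < K by rewrite /K; lra.
have [k [k66 ku ke]] : exists k : nat, [/\ (66 <= k)%N, u <= k%:R & K / e <= k%:R].
  exists (66 + (Num.bound u + Num.bound (K / e)))%N; split; first exact: leq_addr.
    have u0 : 0 <= u by lra.
    by rewrite (le_trans (ltW (archi_boundP u0)))// ler_nat addnCA leq_addr.
  have u0 : 0 <= K / e by rewrite divr_ge0// ltW.
  by rewrite (le_trans (ltW (archi_boundP u0)))// ler_nat addnA leq_addl.
pose m := (k ^ 4)%N; pose F := 'F_2 : finFieldType.
have k0 : (0 < k)%N by exact: leq_trans k66.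
have k1 : 1 <= (k%:R : R) by rewrite ler1n.
have m0 : (0 < m)%N by rewrite expn_gt0 k0.
have M0 : 0 < (m%:R : R) by rewrite ltr0n.
have km : k%:R <= (m%:R : R) by rewrite ler_nat /m -[leqLHS]expn1 leq_exp2l // (leq_trans _ k66).
have V0 : 0 < (m%:R ^- 2 : R) by rewrite invr_gt0 exprn_gt0.
have [H1 H2] := Hd F m k k66 (leqnn _).
have ekm : (k * m)%:R / m%:R = k%:R :> R by rewrite natrM mulfK// gt_eqF.
have mn : (m < k * m)%N by rewrite -[ltnLHS]mul1n ltn_pmul2r// (leq_trans _ k66).
have h1 : `|model_error F R m (k * m)| <= 70 * Cd / m%:R ^+ 2.
  have m66 : (m < 66 * m)%N by rewrite -[ltnLHS]mul1n ltn_pmul2r.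
  have := H1 _ m66; have := H2 (66 * m)%N; rewrite !leq_mul2r k66 !orbT => /(_ isT).
  have -> : (66 * m)%:R / m%:R = 66 :> R by rewrite natrM mulfK// gt_eqF.
  have -> : Cd / m%:R ^+ 3 * (66 * m)%:R = Cd / m%:R ^+ 2 * 66.
    by rewrite natrM; field; rewrite gt_eqF.
  have i4 : invself_e (66 : R) <= 4 by apply: invself_e_le4; lra.
  have CV : 0 < Cd / m%:R ^+ 2 by rewrite mulr_gt0.
  have : Cd / m%:R ^+ 2 * invself_e 66 <= Cd / m%:R ^+ 2 * 4 by rewrite ler_pM2l.
  rewrite -(mulrA 70); move: (Cd / _) (model_error F R m (k * m)) (model_error F R m (66 * m)) => q x y.
  have := ler_normB y (y - x); rewrite subKr; lra.
have h2 : `|rough_prop F R (k * m) m - lambda F R m| <= 4 * Ca / m%:R ^+ 2.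
  have hm : m%:R <= 1 * k%:R ^+ 4 :> R by rewrite mul1r -natrX.
  have := Ha F (k * m)%N m m0 mn; rewrite ekm => /(_ hm).
  move=> /le_trans; apply; rewrite -(mulrA 4) [leRHS]mulrC ler_pM2l ?mulr_gt0//.
  by apply: invself_e_le4.
have h12 := lerD h2 h1.
have h3 : `|expR (- gam) / m%:R - lambda F R m| <= 9 / m%:R ^+ 2.
  have /andP[h3 h4] := lambda_gap F m0.
  have -> : expR (- gam) / m%:R - lambda F R m =
      expR (- gam) * (m%:R^-1 - lambda F R m * expR gam).
    by rewrite mulrBr mulrCA -expRD addNr expR0 mulr1.
  rewrite ger0_norm ?mulr_ge0 ?expR_ge0//; apply: le_trans h4.
  by rewrite ler_piMl// expR_le1 oppr_le0 euler_gamma_ge0.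
have wk : `|w k%:R - expR (- gam)| <= e.
  apply: (@le_trans _ _ (K / m%:R)); last first.
    rewrite ler_pdivrMr// -ler_pdivrMl// mulrC.
    exact: le_trans ke km.
  rewrite -(ler_pM2r (_ : 0 < m%:R^-1)) ?invr_gt0// -{1}(ger0_norm (_ : 0 <= m%:R^-1))//.
  rewrite -normrM mulrBl -mulrA -invfM -expr2.
  have -> : w k%:R / m%:R - expR (- gam) / m%:R =
      (rough_prop F R (k * m) m - lambda F R m) - model_error F R m (k * m) -
      (expR (- gam) / m%:R - lambda F R m) by rewrite /model_error ekm; lra.
  apply: le_trans (ler_normB _ _) _.
  have -> : K / m%:R ^+ 2 = 4 * Ca / m%:R ^+ 2 + 70 * Cd / m%:R ^+ 2 + 9 / m%:R ^+ 2.
    by rewrite /K; lra.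
  apply: (lerD _ h3); apply: (le_trans (ler_normB _ _)); exact: h12.
have -> : w u - expR (- gam) = (w u - w k%:R) + (w k%:R - expR (- gam)) by lra.
rewrite (le_trans (ler_normD _ _))// lerD// distrC.
exact: Hc.
Qed.

(** Replacing the limit of [w] by [w u] costs at most a constant times [u^-u / m]; the bound
    [m <= A u^4 <= 4^4 A e^u] turns this into [m^-2 (u/e)^-u]. *)
Lemma rough_prop_error_large (A : R) : 1 <= A -> exists2 C : R, 0 < C &
  forall (F : finFieldType) (n m : nat), (0 < m)%N -> (m < n)%N ->
  let u := n%:R / m%:R in m%:R <= A * u ^+ 4 ->
  `|rough_prop F R n m - lambda F R m * expR gam * w u| <= C / m%:R ^+ 2 * invself_e u.
Proof.
move=> A1; have [Cr Cr0 Hr] := rough_prop_lambda_le A1.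
have [Cb Cb0 Hb] := buchstab_limit.
have A0 : 0 < A by lra.
have A4 : 0 < 4 ^+ 4 * A by apply: mulr_gt0 => //; exact: exprn_gt0.
exists (Cr + Cb * (4 ^+ 4 * A)); first by rewrite addr_gt0// mulr_gt0.
move=> F n m m0 mn u mA; have M0 : 0 < (m%:R : R) by rewrite ltr0n.
have u1 : 1 <= u by rewrite ler_pdivlMr// mul1r ler_nat ltnW.
have /andP[d1 d2] := lambda_gap F m0.
have -> : rough_prop F R n m - lambda F R m * expR gam * w u =
   (rough_prop F R n m - lambda F R m) - lambda F R m * expR gam * (w u - expR (- gam)).
  have : expR gam * expR (- gam) = 1 by rewrite -expRD subrr expR0.
  by move: (expR gam) (expR (- gam)) => x y xy; rewrite mulrBr -[_ * x * y]mulrA xy; lra.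
rewrite (le_trans (ler_normB _ _))// mulrDl mulrDl lerD//; first exact: Hr.
have L0 : 0 <= lambda F R m * expR gam.
  rewrite mulr_ge0 ?expR_ge0//; have /andP[+ _] := lambda_mertens F m0.
  by apply: le_trans; rewrite divr_ge0 ?expR_ge0.
rewrite normrM (ger0_norm L0).
apply: (@le_trans _ _ (m%:R^-1 * (Cb * invself u))).
  by apply: ler_pM => //; [rewrite -subr_ge0|exact: Hb].
have eu : (u / 4) ^+ 4 <= expR u.
  apply: (@le_trans _ _ (expR (u / 4) ^+ 4)).
    have u0 : 0 <= u by lra.
    apply: lerXn2r; rewrite ?nnegrE ?expR_ge0 ?divr_ge0//.
    by have := expR_ge1Dx (u / 4); lra.
  by rewrite -expRM_natl mulrC divfK.
have mE : m%:R <= 4 ^+ 4 * A * expR u.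
  apply: (le_trans mA); rewrite mulrAC [leRHS]mulrC ler_pM2l; last by lra.
  by rewrite mulrC -ler_pdivrMr ?exprn_gt0// -expr_div_n.
have -> : m%:R^-1 * (Cb * invself u) = Cb * invself u / m%:R ^+ 2 * m%:R.
  by field; rewrite gt_eqF.
have -> : Cb * (4 ^+ 4 * A) / m%:R ^+ 2 * invself_e u =
    Cb * invself u / m%:R ^+ 2 * (4 ^+ 4 * A * expR u) by rewrite invself_eE; ring.
by rewrite ler_wpM2l// !mulr_ge0 ?invr_ge0 ?exprn_ge0 ?(ltW M0) ?(ltW Cb0) ?(ltW (invself_gt0 _)).
Qed.

(** Let [k] be the integer part of the fourth root of [m]. The estimate for large [u] covers [u > k]
    and small [k]; otherwise the error at [n] is compared with that at [k m], where the same
    estimate applies. *)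
Lemma rough_prop_error : exists2 C : R, 0 < C &
  forall (F : finFieldType) (n m : nat), (0 < m)%N -> (m < n)%N ->
  `|rough_prop F R n m - lambda F R m * expR gam * w (n%:R / m%:R)| <=
    C / m%:R ^+ 2 * invself_e (n%:R / m%:R).
Proof.
(* As [m < (k + 1)^4], this covers both [k < 66] and [u >= k], where [k + 1 <= 67 u]. *)
pose A : R := 67 ^+ 4.
have A1 : 1 <= A by rewrite exprn_ege1//; lra.
have [Ce Ce0 He] := rough_prop_error_large A1.
have [Cb Cb0 Hb] := buchstab_cauchy R.
have [Cd Cd0 Hd] := model_error_decay R.
have i65 := @invself_e_gt0 R 65.
pose D := (65 * Cd + 9) / invself_e 65.
have D0 : 0 < D by rewrite divr_gt0//; lra.
exists (Ce + D + Cd + 9 * Cb); first by lra.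
move=> F n m m0 mn; pose u : R := n%:R / m%:R; rewrite -/u.
have M0 : 0 < (m%:R : R) by rewrite ltr0n.
have V0 : 0 < (m%:R ^- 2 : R) by rewrite invr_gt0 exprn_gt0.
have u1 : 1 <= u by rewrite ler_pdivlMr// mul1r ler_nat ltnW.
have p0 := invself_e_gt0 u.
have Vp0 : 0 < m%:R ^- 2 * invself_e u by rewrite mulr_gt0.
have weaken (c : R) : c <= Ce + D + Cd + 9 * Cb ->
    c / m%:R ^+ 2 * invself_e u <= (Ce + D + Cd + 9 * Cb) / m%:R ^+ 2 * invself_e u.
  by move=> cC; rewrite -!mulrA ler_pM2r.
have [k km mk] := fourth_root m.
have mk1 : m%:R <= (k%:R + 1) ^+ 4 :> R by rewrite natr1 -natrX ler_nat ltnW.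
have large (v : R) : 1 <= v -> k%:R + 1 <= 67 * v -> m%:R <= A * v ^+ 4.
  move=> v1 kv; apply: (le_trans mk1); rewrite -exprMn; by apply: lerXn2r; rewrite ?nnegrE ?addr_ge0//; lra.
have [k66|k66] := ltnP k 66.
  apply: (le_trans (He F n m m0 mn (large u u1 _))); last by apply: weaken; lra.
  have : k%:R + 1 <= 67 :> R by rewrite natr1 ler_nat ltnW.
  by lra.
have k66' : 66 <= k%:R :> R by rewrite ler_nat.
have [uk|uk] := ltP k%:R u.
  apply: (le_trans (He F n m m0 mn (large u u1 _))); last by apply: weaken; lra.
  lra.
have [H1 H2] := Hd F m k k66 km.
have /andP[g0 g9] := lambda_gap F m0.
set gap := _ - _ in g0 g9.
have err n' : rough_prop F R n' m - lambda F R m * expR gam * w (n'%:R / m%:R) =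
    model_error F R m n' + gap * w (n'%:R / m%:R).
  by rewrite /model_error /gap; lra.
(* Below [65 m], [invself_e u] is bounded below, so an error [O(m^-2)] is enough. *)
have [n65|n65] := ltnP n (65 * m).
  rewrite err -/u; apply: (@le_trans _ _ ((65 * Cd + 9) / m%:R ^+ 2)).
    have -> : (65 * Cd + 9) / m%:R ^+ 2 = 65 * Cd / m%:R ^+ 2 + 9 / m%:R ^+ 2 by lra.
    apply: (le_trans (ler_normD _ _)); apply: lerD.
      apply: le_trans (H1 n mn) _.
      have -> : 65 * Cd / m%:R ^+ 2 = Cd / m%:R ^+ 3 * (65 * m%:R) by field; rewrite gt_eqF.
      rewrite ler_pM2l ?mulr_gt0 ?invr_gt0 ?exprn_gt0//.
      by rewrite -natrM ler_nat ltnW.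
    have /andP[w1 w2] := buchstab_bounds u1.
    rewrite normrM (ger0_norm g0) ger0_norm; last by lra.
    by apply: le_trans g9; rewrite ler_piMr.
  apply: (@le_trans _ _ (D / m%:R ^+ 2 * invself_e u)); last by apply: weaken; lra.
  rewrite [leRHS]mulrAC ler_pM2r// /D -(mulrA (65 * Cd + 9)) ler_peMr//; first lra.
  rewrite mulrC ler_pdivlMr// mul1r; apply: invself_e_nincr => //.
  by rewrite ler_pdivrMr// -natrM ler_nat ltnW.
have nk : (n <= k * m)%N by move: uk; rewrite ler_pdivrMr// -natrM ler_nat.
have mkm : (m < k * m)%N by rewrite -[ltnLHS]mul1n ltn_pmul2r// (leq_trans _ k66).
have ekm : (k * m)%:R / m%:R = k%:R :> R by rewrite natrM mulfK// gt_eqF.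
have -> : rough_prop F R n m - lambda F R m * expR gam * w u =
    (rough_prop F R (k * m) m - lambda F R m * expR gam * w ((k * m)%:R / m%:R)) +
    ((model_error F R m n - model_error F R m (k * m)) + gap * (w u - w k%:R)).
  by rewrite err -/u err ekm; lra.
have k1 : 1 <= k%:R :> R by lra.
have e1 : `|rough_prop F R (k * m) m - lambda F R m * expR gam * w ((k * m)%:R / m%:R)|
    <= Ce / m%:R ^+ 2 * invself_e u.
  apply: (@le_trans _ _ (Ce / m%:R ^+ 2 * invself_e k%:R)).
    rewrite -[in X in _ <= X]ekm; apply: He => //; rewrite ekm; apply: large => //; lra.
  by rewrite ler_pM2l ?mulr_gt0// invself_e_nincr.
have e2 : `|model_error F R m n - model_error F R m (k * m)| <= Cd / m%:R ^+ 2 * invself_e u.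
  by apply: H2; rewrite n65.
have e3 : `|gap * (w u - w k%:R)| <= 9 * Cb / m%:R ^+ 2 * invself_e u.
  rewrite normrM (ger0_norm g0) (_ : 9 * Cb / _ * _ = 9 / m%:R ^+ 2 * (Cb * invself_e u)); last by ring.
  apply: ler_pM => //; rewrite distrC; apply: (le_trans (Hb u k%:R u1 uk)).
  rewrite ler_pM2l// invself_eE ler_peMl ?(ltW (invself_gt0 _))//.
  by have := expR_ge1Dx u; lra.
apply: (le_trans (ler_normD _ _)); apply: (le_trans (lerD e1 (le_trans (ler_normD _ _) (lerD e2 e3)))).
rewrite -!mulrDl -!mulrA ler_pM2r//; lra.
Qed.

End Asymptotics.

(** * From absolute to relative errors *)

Lemma eq_mul1O_error (R : realType) (C a b E : R) :
  0 < b -> `|a - b| <= C * E * b -> eq_mul1O C a b E.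
Proof.
move=> b0 ab; exists ((a - b) / b).
  by rewrite mulrDr mulr1 mulrCA divff ?gt_eqF// mulr1 addrC subrK.
by rewrite normrM normfV (gtr0_norm b0) ler_pdivrMr.
Qed.

Lemma powR_half_nat (R : realType) (x : R) n : 0 <= x -> x `^ (n%:R / 2) = Num.sqrt x ^+ n.
Proof.
by move=> x0; rewrite mulrC powRrM powR12_sqrt// powR_mulrn// sqrtr_ge0.
Qed.

Theorem theorem1p2 (R : realType) :
  exists C1 C2 C3 : R,
    (forall (F : finFieldType) (n m : nat), (1 <= m)%N -> (m < n)%N ->
       let u : R := n%:R / m%:R in
       eq_mul1O C1 (rough_prop F R n m)
         (lambda F R m * expR (euler_gamma R) * buchstab u)
         ((u / expR 1) `^ (- u) / m%:R))
    /\
    (forall (F : finFieldType) (m : nat), (1 <= m)%N ->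
       eq_mul1O C2 (lambda F R m) (expR (- Hsum R m))
         (1 / (m%:R * #|F|%:R `^ (m.+1%:R / 2)))
       /\
       eq_mul1O C3 (lambda F R m) (expR (- euler_gamma R) / m%:R)
         (1 / m%:R)).
Proof.
have [C C0 HC] := rough_prop_error R.
(* The main term is at least [1 / (2 e^9 m)], by [w >= 1/2] and [lambda e^gamma >= expR (- 9) / m].
   The constants [8] and [9] come from [lambda_bounds] and [lambda_gap]. *)
exists (2 * expR 9 * C), 8, 9; split.
  move=> F n m m1 mn u; have M0 : 0 < (m%:R : R) by rewrite ltr0n.
  have u1 : 1 <= u by rewrite ler_pdivlMr// mul1r ler_nat ltnW.
  have u0 : 0 < u by exact: lt_le_trans u1.
  have /andP[w1 _] := buchstab_bounds u1.
  have E0 := expR_gt0 (euler_gamma R); have E9 := expR_gt0 (9 : R).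
  have b_ge : (2 * expR 9 * m%:R)^-1 <= lambda F R m * expR (euler_gamma R) * buchstab u.
    have -> : (2 * expR 9 * m%:R)^-1 = (expR 9)^-1 / m%:R * 2^-1 :> R.
      by field; rewrite !gt_eqF.
    apply: ler_pM => //.
    have /andP[l1 _] := lambda_mertens R F m1.
    rewrite -(ler_pM2r E0) in l1; apply: le_trans l1.
    rewrite mulrAC -expRD -expRN ler_pM2r ?invr_gt0// ler_expR.
    have : 9 / m%:R <= 9 :> R by rewrite ler_pdivrMr// ler_peMr// ler1n.
    by lra.
  have b0 : 0 < lambda F R m * expR (euler_gamma R) * buchstab u.
    by apply: lt_le_trans b_ge; rewrite invr_gt0 !mulr_gt0.
  apply: eq_mul1O_error => //; apply: le_trans (HC F n m m1 mn) _.
  rewrite -/u invself_eP//; have p0 := invself_e_gt0 u.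
  have -> : C / m%:R ^+ 2 * invself_e u =
      2 * expR 9 * C * (invself_e u / m%:R) * (2 * expR 9 * m%:R)^-1.
    by field; rewrite !gt_eqF.
  by rewrite ler_wpM2l// !mulr_ge0// ?invr_ge0 ltW.
move=> F m m1; have M0 : 0 < (m%:R : R) by rewrite ltr0n.
split.
  apply: eq_mul1O_error; rewrite ?expR_gt0// powR_half_nat// div1r.
  have /andP[l1 l2] := lambda_bounds F R m1.
  rewrite ler0_norm ?subr_le0// opprB lerBlDr -lerBlDl.
  apply: le_trans l1; rewrite opprD expRD [leRHS]mulrC.
  rewrite [leLHS](_ : _ = (1 + - (8 / (m%:R * Num.sqrt #|F|%:R ^+ m.+1))) * expR (- Hsum R m)).
    by rewrite ler_pM2r ?expR_gt0// expR_ge1Dx.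
  by ring.
have /andP[g0 g9] := lambda_gap R F m1.
have E0 := expR_gt0 (euler_gamma R).
apply: eq_mul1O_error; first by rewrite divr_gt0 ?expR_gt0.
have -> : lambda F R m - expR (- euler_gamma R) / m%:R =
    - (expR (- euler_gamma R) * (m%:R^-1 - lambda F R m * expR (euler_gamma R))).
  by rewrite mulrBr mulrCA -expRD addNr expR0 mulr1 opprB.
rewrite normrN ger0_norm ?mulr_ge0 ?expR_ge0// [leRHS]mulrCA ler_pM2l ?expR_gt0//.
by rewrite div1r -mulrA -invfM -expr2.
Qed.
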